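(* Balanced Cluster Editing admits an algorithm that, on an instance $(G,k,\eta)$ where $G$ has $n$ vertices, correctly decides the instance in time $2^{\mathcal{O}(k)}n^{\mathcal{O}(1)}$.
   Context: All graphs are finite and simple. A cluster graph is a graph in which every connected component is a clique. For a non-negative integer $\eta$, a graph is $\eta$-balanced if for any two connected components $H,H'$ we have $\big||V(H)|-|V(H')|\big|\le\eta$. Balanced Cluster Editing: given a graph $G$ and non-negative integers $k,\eta$, decide whether there is $F\subseteq\binom{V(G)}{2}$ with $|F|\le k$ such that the graph $(V(G),E(G)\triangle F)$ is an $\eta$-balanced cluster graph. *)

(* Defs.v *)
From mathcomp Require Import all_boot all_order all_algebra.

Set Implicit Arguments.
Unset Strict Implicit.
Unset Printing Implicit Defensive.

(* A finite simple graph is a pair (V, E): the vertex set is the finType [T]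
   and the edge set is some [E : {set {set T}}] with [E \subset pairs T]. *)

Section Graphs.
Variable T : finType.
Implicit Types (E F : {set {set T}}) (H : {set T}) (x y : T).

Definition pairs : {set {set T}} := [set e : {set T} | #|e| == 2].

(* If [E \subset pairs], this relation is irreflexive, as [set x; x] is a
   singleton. *)
Definition adj E : rel T := fun x y => [set x; y] \in E.

Definition component E x : {set T} := [set y | connect (adj E) x y].

Definition components E : {set {set T}} := [set component E x | x : T].

Definition clique E H : bool :=
  [forall x in H, forall y in H, (x != y) ==> adj E x y].

Definition cluster E : bool := [forall H in components E, clique E H].

Definition balanced (eta : nat) E : bool :=
  [forall H in components E, forall H' in components E,
     `|#|H| - #|H'| |%N <= eta].

Definition symdiff E F : {set {set T}} := (E :\: F) :|: (F :\: E).

Definition balanced_cluster_editing E (k eta : nat) : bool :=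
  [exists F : {set {set T}},
     [&& F \subset pairs, #|F| <= k,
         cluster (symdiff E F) & balanced eta (symdiff E F)]].

End Graphs.

(* Model of computation: structured programs for a unit-cost random access
   machine with natural-number registers and an indirectly addressed memory.
   The only arithmetic operations are addition and truncated subtraction.
   There is no multiplication or shift, so a step increases the bit length of
   the largest stored value by at most one (constants aside); hence unit cost is
   polynomially related to Turing machine time. *)

Inductive instr : Type :=
  | Const of nat & nat          (* Const r c   : r := c        *)
  | Add of nat & nat & nat      (* Add r a b   : r := a + b    *)
  | Sub of nat & nat & nat      (* Sub r a b   : r := a - b    *)
  | Read of nat & nat           (* Read r a    : r := mem[a]   *)
  | Write of nat & nat.         (* Write a b   : mem[a] := b   *)

Inductive prog : Type :=
  | Skip
  | Instr of instr
  | Seq of prog & prog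
  | If of nat & prog & prog     (* branch on register != 0 *)
  | While of nat & prog.        (* loop while register != 0 *)

Record state : Type := State { regs : nat -> nat; mem : nat -> nat }.

Definition upd (f : nat -> nat) (i v : nat) : nat -> nat :=
  fun j => if j == i then v else f j.

Definition set_reg (s : state) (r v : nat) : state :=
  State (upd (regs s) r v) (mem s).

Definition run_instr (i : instr) (s : state) : state :=
  match i with
  | Const r c => set_reg s r c
  | Add r a b => set_reg s r (regs s a + regs s b)
  | Sub r a b => set_reg s r (regs s a - regs s b)
  | Read r a => set_reg s r (mem s (regs s a))
  | Write a b => State (regs s) (upd (mem s) (regs s a) (regs s b))
  end.

(* [exec p s t s']: started in [s], program [p] halts in [s'] after exactly
   [t] steps; every instruction and every test costs one step. *)
Inductive exec : prog -> state -> nat -> state -> Prop :=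
  | ExecSkip s : exec Skip s 1 s
  | ExecInstr i s : exec (Instr i) s 1 (run_instr i s)
  | ExecSeq p q s t s' t' s'' :
      exec p s t s' -> exec q s' t' s'' -> exec (Seq p q) s (t + t') s''
  | ExecIfTrue r p q s t s' :
      regs s r != 0 -> exec p s t s' -> exec (If r p q) s t.+1 s'
  | ExecIfFalse r p q s t s' :
      regs s r = 0 -> exec q s t s' -> exec (If r p q) s t.+1 s'
  | ExecWhileTrue r p s t s' t' s'' :
      regs s r != 0 -> exec p s t s' -> exec (While r p) s' t' s'' ->
      exec (While r p) s (t + t').+1 s''
  | ExecWhileFalse r p s :
      regs s r = 0 -> exec (While r p) s 1 s.

(* Input convention: registers 0, 1, 2 hold n, k, eta; memory cells
   0, ..., n^2 - 1 hold the adjacency matrix in row-major order; everything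
   else is 0. *)
Definition input (n : nat) (E : {set {set 'I_n}}) (k eta : nat) : state :=
  State (fun r => nth 0 [:: n; k; eta] r)
        (fun a => [exists i : 'I_n, exists j : 'I_n,
                     (a == i * n + j) && adj E i j] : bool).

Definition output (s : state) : nat := regs s 0.

(* Main.v *)
Require Import Defs.
From mathcomp Require Import all_boot all_order all_algebra.
From mathcomp Require Import zify.
From Stdlib Require Import Classical_Prop.

Set Implicit Arguments.
Unset Strict Implicit.
Unset Printing Implicit Defensive.

(* The program tries, for every lower bound lo <= n on the cluster sizes, every
   certificate of O(k) bits, and checks each of them in polynomial time.

   The first part of a certificate steers the usual branching: while the graph
   contains an induced path i - j - l, it says which of the three pairs to edit.
   After k + 1 sweeps over all triples, either more than k edits were made or the
   graph is a cluster graph.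

   It remains to turn a cluster graph into one with cluster sizes in
   [lo, lo + eta] by few edits.  If x(a, b) vertices move from the old component a
   to the new cluster b, the number of edits is
   1/2 (sum_a x(a, .)^2 + sum_b x(., b)^2 - 2 sum x(a, b)^2).  Components untouched
   by the edits play no role, and with c edits at most 2c vertices are touched.
   For fixed row and column sums the cost is concave in x, so pushing one unit back
   and forth along a cycle of the bipartite support of x improves the cost in one
   of the two directions: an optimal x has a forest as support.  Such an x is
   described, up to the names of the components, by a depth-first traversal of the
   forest with edge weights written in unary, which takes O(k) symbols; the names
   do not matter since only the number of components of each size does.  A stack
   machine reads the traversal, computes the cost and checks all sizes.

   The program is written in a language whose only loops are counted loops with
   a fixed bound.  It has a total semantics, and the running time of the compiled
   program is a polynomial in the largest loop bound 2^(32k) (n + 1)^2. *)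

(** * A loop language and its compilation *)

(** Writing down directly which vertices go where is too expensive: a name among [n] components
    takes [log n] bits, and even a name among [O(k)] candidates makes the total [k log k]. A
    traversal word contains no names. Branching loses nothing: against a fixed target cluster graph
    it can be steered so that each edit hits a pair on which the current graph and the target
    differ. The distance to the target drops by one per edit, which leaves exactly the rest of the
    budget for the redistribution. Origin of 32: at most [2k] vertices are touched, each counted in
    one component and one cluster, so the degrees of the forest add up to at most [4k]. A node of
    degree [s > 0] takes at most [s + 2 <= 3s] tokens, hence [12k] tokens. With at most [k]
    branching choices this makes [13k] digits in base 4, or [26k] bits; 32 is the next power of two,
    reachable by doublings. *)

Inductive expr :=
  | Var of nat
  | Cst of nat
  | Plus of expr & expr
  | Minus of expr & expr
  | Fetch of expr.

Inductive com :=
  | CSkip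
  | Asg of nat & expr
  | Store of expr & expr
  | CSeq of com & com
  | Cond of expr & com & com
  | For of nat & nat & com.

Fixpoint eval (s : state) (e : expr) : nat :=
  match e with
  | Var r => regs s r
  | Cst c => c
  | Plus a b => eval s a + eval s b
  | Minus a b => eval s a - eval s b
  | Fetch a => Defs.mem s (eval s a)
  end.

Definition store (s : state) (a v : nat) : state :=
  State (regs s) (upd (Defs.mem s) a v).

Definition incr (r : nat) (s : state) : state := set_reg s r (regs s r).+1.

Fixpoint sem (c : com) (s : state) : state :=
  match c with
  | CSkip => s
  | Asg r e => set_reg s r (eval s e)
  | Store a e => store s (eval s a) (eval s e)
  | CSeq c1 c2 => sem c2 (sem c1 s)
  | Cond e c1 c2 => if eval s e != 0 then sem c1 s else sem c2 s
  | For r l b => iter (regs s l) (fun s => incr r (sem b s)) (set_reg s r 0)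
  end.

Fixpoint mods (c : com) : seq nat :=
  match c with
  | CSkip | Store _ _ => [::]
  | Asg r _ => [:: r]
  | CSeq c1 c2 | Cond _ c1 c2 => mods c1 ++ mods c2
  | For r _ b => r :: mods b
  end.

Fixpoint limits (c : com) : seq nat :=
  match c with
  | CSkip | Store _ _ | Asg _ _ => [::]
  | CSeq c1 c2 | Cond _ c1 c2 => limits c1 ++ limits c2
  | For _ l b => l :: limits b
  end.

Fixpoint expr_below (K : nat) (e : expr) : bool :=
  match e with
  | Var r => r < K
  | Cst _ => true
  | Plus a b | Minus a b => expr_below K a && expr_below K b
  | Fetch a => expr_below K a
  end.

Fixpoint com_below (K : nat) (c : com) : bool :=
  match c with
  | CSkip => true
  | Asg r e => (r < K) && expr_below K e
  | Store a e => expr_below K a && expr_below K e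
  | CSeq c1 c2 => com_below K c1 && com_below K c2
  | Cond e c1 c2 => [&& expr_below K e, com_below K c1 & com_below K c2]
  | For r l b => [&& r < K, l < K, r \notin mods b & com_below K b]
  end.

(** When no command changes a limit register, one bound on the initial values bounds every iteration
    count, however deeply the loop is nested. *)
Definition limits_fixed (c : com) : bool :=
  all (fun r => r \notin mods c) (limits c).

Lemma sem_frame c s r : r \notin mods c -> regs (sem c s) r = regs s r.
Proof.
elim: c s => [|r' e|a e|c1 IH1 c2 IH2|e c1 IH1 c2 IH2|r' l b IHb] s //=.
- by rewrite inE /upd => /negbTE ->.
- by rewrite mem_cat negb_or => /andP[h1 h2]; rewrite IH2 // IH1.
- by rewrite mem_cat negb_or => /andP[h1 h2]; case: ifP => _; rewrite ?IH1 ?IH2.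
- rewrite inE negb_or => /andP[/negbTE h1 h2].
  elim: (regs s l) => [|m IHm] /=; first by rewrite /upd h1.
  by rewrite /upd h1 IHb // IHm.
Qed.

Fixpoint compile_expr (d : nat) (e : expr) : prog :=
  match e with
  | Var r => Seq (Instr (Const d 0)) (Instr (Add d d r))
  | Cst c => Instr (Const d c)
  | Plus a b =>
      Seq (compile_expr d a) (Seq (compile_expr d.+1 b) (Instr (Add d d d.+1)))
  | Minus a b =>
      Seq (compile_expr d a) (Seq (compile_expr d.+1 b) (Instr (Defs.Sub d d d.+1)))
  | Fetch a => Seq (compile_expr d a) (Instr (Read d d))
  end.

(* Registers from [K] on hold intermediate results. *)
Fixpoint compile (K : nat) (c : com) : prog :=
  match c with
  | CSkip => Skip
  | Asg r e =>
      Seq (compile_expr K e) (Seq (Instr (Const K.+1 0)) (Instr (Add r K K.+1)))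
  | Store a e =>
      Seq (compile_expr K a) (Seq (compile_expr K.+1 e) (Instr (Write K K.+1)))
  | CSeq c1 c2 => Seq (compile K c1) (compile K c2)
  | Cond e c1 c2 => Seq (compile_expr K e) (If K (compile K c1) (compile K c2))
  | For r l b =>
      Seq (Instr (Const r 0)) (Seq (Instr (Defs.Sub K l r))
        (While K (Seq (compile K b) (Seq (Instr (Const K 1))
           (Seq (Instr (Add r r K)) (Instr (Defs.Sub K l r)))))))
  end.

Fixpoint expr_time (e : expr) : nat :=
  match e with
  | Var _ => 2
  | Cst _ => 1
  | Plus a b | Minus a b => expr_time a + (expr_time b + 1)
  | Fetch a => expr_time a + 1
  end.

(** [B] bounds all loop limits. The 4 pays for the loop test and the three instructions that update
    the counter and the test register; the 3 pays for the initialisation and the failing test. *)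
Fixpoint com_time (B : nat) (c : com) : nat :=
  match c with
  | CSkip => 1
  | Asg _ e => expr_time e + 2
  | Store a e => expr_time a + (expr_time e + 1)
  | CSeq c1 c2 => com_time B c1 + com_time B c2
  | Cond e c1 c2 => expr_time e + (com_time B c1 + com_time B c2).+1
  | For _ _ b => B * (com_time B b + 4) + 3
  end.

Lemma com_time_poly c : exists C d, forall B, com_time B c <= C * B.+1 ^ d.
Proof.
have ge1 B d : 0 < B.+1 ^ d by rewrite expn_gt0.
have two c1 c2 : (exists C d, forall B, com_time B c1 <= C * B.+1 ^ d) ->
    (exists C d, forall B, com_time B c2 <= C * B.+1 ^ d) ->
  exists C d, forall B, com_time B c1 + com_time B c2 <= C * B.+1 ^ d.
  move=> [C1 [d1 h1]] [C2 [d2 h2]]; exists (C1 + C2), (d1 + d2) => B.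
  rewrite mulnDl expnD; apply: leq_add.
    by apply: (leq_trans (h1 B)); rewrite leq_mul2l leq_pmulr ?orbT.
  by apply: (leq_trans (h2 B)); rewrite leq_mul2l leq_pmull ?orbT.
elim: c => [|r e|a e|c1 IH1 c2 IH2|e c1 IH1 c2 IH2|r l b [C [d IHb]]] /=.
- by exists 1, 0.
- by exists (expr_time e + 2), 0 => B; rewrite expn0 muln1.
- by exists (expr_time a + (expr_time e + 1)), 0 => B; rewrite expn0 muln1.
- exact: two.
- have [C [d h]] := two _ _ IH1 IH2; exists (expr_time e + 1 + C), d => B.
  by have := h B; have := ge1 B d; nia.
- exists (C + 7), d.+1 => B; rewrite expnS.
  by have := IHb B; have := ge1 B d; nia.
Qed.

Definition agree (K : nat) (s s' : state) : Prop :=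
  (forall r, r < K -> regs s r = regs s' r) /\ Defs.mem s =1 Defs.mem s'.

Lemma eval_agree K s s' e :
  expr_below K e -> agree K s s' -> eval s e = eval s' e.
Proof.
move=> + [h1 h2]; elim: e => [r|c|a IHa b IHb|a IHa b IHb|a IHa] //=.
- exact: h1.
- by case/andP=> /IHa -> /IHb ->.
- by case/andP=> /IHa -> /IHb ->.
- by move/IHa ->.
Qed.

(** Only registers from [d] on are written, so a left operand held in [d] survives the evaluation of
    the right one in [d.+1]. *)
Lemma compile_expr_correct K d e s : expr_below K e -> K <= d ->
  exists s', [/\ exec (compile_expr d e) s (expr_time e) s',
    regs s' d = eval s e, (forall r, r < d -> regs s' r = regs s r) &
    Defs.mem s' = Defs.mem s].
Proof.
have two a b (op : nat -> nat -> nat -> instr) (f : nat -> nat -> nat) :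
    (forall r x y s, run_instr (op r x y) s = set_reg s r (f (regs s x) (regs s y))) ->
    (forall d s, expr_below K a -> K <= d -> exists s',
      [/\ exec (compile_expr d a) s (expr_time a) s', regs s' d = eval s a,
       (forall r, r < d -> regs s' r = regs s r) & Defs.mem s' = Defs.mem s]) ->
    (forall d s, expr_below K b -> K <= d -> exists s',
      [/\ exec (compile_expr d b) s (expr_time b) s', regs s' d = eval s b,
       (forall r, r < d -> regs s' r = regs s r) & Defs.mem s' = Defs.mem s]) ->
  forall d s, expr_below K a && expr_below K b -> K <= d -> exists s',
  [/\ exec (Seq (compile_expr d a) (Seq (compile_expr d.+1 b) (Instr (op d d d.+1)))) s
       (expr_time a + (expr_time b + 1)) s',
     regs s' d = f (eval s a) (eval s b),
     (forall r, r < d -> regs s' r = regs s r) & Defs.mem s' = Defs.mem s].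
  move=> hop IHa IHb d0 s0 /andP[wa wb] Kd.
  have [s1 [x1 v1 r1 m1]] := IHa d0 s0 wa Kd.
  have [s2 [x2 v2 r2 m2]] := IHb d0.+1 s1 wb (leqW Kd).
  have e2 : eval s1 b = eval s0 b.
    apply: (@eval_agree K) wb _; split=> [r rK|x]; last by rewrite m1.
    by rewrite r1 // (leq_trans rK).
  exists (run_instr (op d0 d0 d0.+1) s2); split.
  - by apply: ExecSeq x1 _; apply: ExecSeq x2 _; apply: ExecInstr.
  - by rewrite hop /= /upd eqxx r2 // v1 v2 e2.
  - by move=> r rd; rewrite hop /= /upd (ltn_eqF rd) r2 ?r1 // ltnW.
  - by rewrite hop /= m2.
elim: e d s => [r|c|a IHa b IHb|a IHa b IHb|a IHa] d s.
- move=> rK Kd; eexists; split.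
  + by apply: (@ExecSeq _ _ _ 1 _ 1); apply: ExecInstr.
  + by rewrite /= /upd eqxx (ltn_eqF (leq_trans rK Kd)).
  + by move=> r' r'd; rewrite /= /upd (ltn_eqF r'd).
  + by [].
- move=> _ Kd; eexists; split; [exact: ExecInstr| | |] => //=.
  + by rewrite /upd eqxx.
  + by move=> r' r'd; rewrite /= /upd (ltn_eqF r'd).
- exact: (two _ _ Add).
- exact: (two _ _ Defs.Sub).
- move=> wa Kd; have [s1 [x1 v1 r1 m1]] := IHa d s wa Kd.
  eexists; split; first by apply: ExecSeq x1 _; apply: ExecInstr.
  + by rewrite /= /upd eqxx v1 m1.
  + by move=> r rd; rewrite /= /upd (ltn_eqF rd) r1.
  + by rewrite /= m1.
Qed.

Lemma compile_correct K B c s sg :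
  com_below K c -> limits_fixed c ->
  (forall r, r \in limits c -> regs sg r <= B) -> agree K s sg ->
  exists t s', [/\ exec (compile K c) s t s', t <= com_time B c &
                   agree K s' (sem c sg)].
Proof.
rewrite /limits_fixed.
elim: c s sg => [|r e|a e|c1 IH1 c2 IH2|e c1 IH1 c2 IH2|r l b IHb] s sg /=.
- by move=> _ _ _ h; exists 1, s; split=> //; exact: ExecSkip.
- move=> /andP[rK we] _ _ h.
  have [s1 [x1 v1 r1 m1]] := compile_expr_correct s we (leqnn K).
  eexists _; eexists; split.
  + by apply: ExecSeq x1 _; apply: (@ExecSeq _ _ _ 1 _ 1); apply: ExecInstr.
  + by [].
  + split=> [r' r'K|x] /=; last by rewrite m1; case: h.
    rewrite /upd; case: eqP => // _; last first.
      by rewrite (ltn_eqF (leqW r'K)) r1 //; case: h => ->.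
    by rewrite eqxx addn0 (ltn_eqF (leqnn K.+1)) v1 (eval_agree we h).
- move=> /andP[wa we] _ _ h.
  have [s1 [x1 v1 r1 m1]] := compile_expr_correct s wa (leqnn K).
  have [s2 [x2 v2 r2 m2]] := compile_expr_correct s1 we (leqnSn K).
  have h1 : agree K s1 sg.
    by case: h => ha hb; split=> [r rK|x]; rewrite ?r1 ?m1 ?ha ?hb.
  eexists _; eexists; split.
  + by apply: ExecSeq x1 _; apply: ExecSeq x2 _; apply: ExecInstr.
  + by [].
  + split=> [r rK|x] /=.
      by rewrite r2 ?ltnS 1?ltnW //; case: h1 => ->.
    rewrite /upd r2 // v1 v2 (eval_agree we h1) (eval_agree wa h) m2.
    by case: h1 => _ ->.
- move=> /andP[w1 w2] /allP f lB h.
  have [||t1 [s1 [x1 T1 h1]]] := IH1 s sg w1 _ _ h.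
  + apply/allP=> r rl; have := f r; rewrite !mem_cat rl => /(_ isT).
    by rewrite negb_or => /andP[].
  + by move=> r rl; apply: lB; rewrite mem_cat rl.
  have [||t2 [s2 [x2 T2 h2]]] := IH2 s1 _ w2 _ _ h1.
  + apply/allP=> r rl; have := f r; rewrite !mem_cat rl orbT => /(_ isT).
    by rewrite negb_or => /andP[].
  + move=> r rl; rewrite sem_frame; first by apply: lB; rewrite mem_cat rl orbT.
    have := f r; rewrite !mem_cat rl orbT => /(_ isT).
    by rewrite negb_or => /andP[].
  by exists (t1 + t2), s2; split=> //; [apply: ExecSeq x1 x2 | apply: leq_add].
- move=> /and3P[we w1 w2] /allP f lB h.
  have [s0 [x0 v0 r0 m0]] := compile_expr_correct s we (leqnn K).
  have h0 : agree K s0 sg.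
    by case: h => ha hb; split=> [r rK|x]; rewrite ?r0 ?m0 ?ha ?hb.
  rewrite -(eval_agree we h) -v0; case: ifP => [b0|/negbFE/eqP b0].
  + have [||t1 [s1 [x1 T1 h1]]] := IH1 s0 sg w1 _ _ h0.
    * apply/allP=> r rl; have := f r; rewrite !mem_cat rl => /(_ isT).
      by rewrite negb_or => /andP[].
    * by move=> r rl; apply: lB; rewrite mem_cat rl.
    exists (expr_time e + t1.+1), s1; split=> //; last by lia.
    by apply: ExecSeq x0 _; apply: ExecIfTrue.
  + have [||t2 [s2 [x2 T2 h2]]] := IH2 s0 sg w2 _ _ h0.
    * apply/allP=> r rl; have := f r; rewrite !mem_cat rl orbT => /(_ isT).
      by rewrite negb_or => /andP[].
    * by move=> r rl; apply: lB; rewrite mem_cat rl orbT.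
    exists (expr_time e + t2.+1), s2; split=> //; last by lia.
    by apply: ExecSeq x0 _; apply: ExecIfFalse.
- move=> /and4P[rK lK rb wb] /andP[lf /allP f] lB h.
  move: lf; rewrite inE negb_or => /andP[lr lb].
  pose body := Seq (compile K b) (Seq (Instr (Const K 1))
           (Seq (Instr (Add r r K)) (Instr (Defs.Sub K l r)))).
  pose L := regs sg l.
  have LB : L <= B by apply: lB; rewrite inE eqxx.
  (* Register [K] holds the number [m] of iterations left. It is recomputed as [l - r] after each
     body, which may have overwritten it. *)
  suff loop m s0 sg0 : agree K s0 sg0 -> regs s0 K = m -> regs sg0 r + m = L ->
      (forall r', r' \in limits b -> regs sg0 r' <= B) -> regs sg0 l = L ->
      exists t s', [/\ exec (While K body) s0 t s',
        t <= m * (com_time B b + 4) + 1 &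
        agree K s' (iter m (fun s => incr r (sem b s)) sg0)].
    pose s1 := run_instr (Defs.Sub K l r) (run_instr (Const r 0) s).
    have es1 : regs s1 K = L.
      rewrite /s1 /= /upd eqxx (negbTE lr) eqxx subn0.
      by case: h => -> .
    have [||||t [s' [x T h']]] := loop L s1 (set_reg sg r 0) _ es1.
    + case: h => ha hb; split=> [r' r'K|x] //=.
      by rewrite /upd (ltn_eqF r'K); case: eqP => // _; apply: ha.
    + by rewrite /= /upd eqxx.
    + move=> r' r'b; rewrite /= /upd; case: eqP => // _.
      by apply: lB; rewrite inE r'b orbT.
    + by rewrite /= /upd (negbTE lr).
    exists (1 + (1 + t)), s'; split=> //.
    + by apply: ExecSeq; [exact: ExecInstr | apply: ExecSeq x; exact: ExecInstr].
    + by have := leq_mul LB (leqnn (com_time B b + 4)); lia.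
  elim: m s0 sg0 => [|m IHm] s0 sg0 h0 hK hr hl hL.
    by exists 1, s0; split=> //; apply: ExecWhileFalse.
  have [|t1 [s1 [x1 T1 h1]]] := IHb s0 sg0 wb _ hl h0.
    apply/allP=> r' r'l; have := f r' r'l.
    by rewrite inE negb_or => /andP[].
  pose s2 := run_instr (Defs.Sub K l r) 
    (run_instr (Add r r K) (run_instr (Const K 1) s1)).
  pose sg1 := incr r (sem b sg0).
  have nK : (r == K) = false by rewrite ltn_eqF.
  have a2 : agree K s2 sg1.
    case: h1 => ha hb; split=> [r' r'K|x] //=.
    rewrite /upd (ltn_eqF r'K) eqxx nK addn1.
    by case: eqP => [_|_]; rewrite ha.
  have r1 : regs sg1 r = (regs sg0 r).+1.
    by rewrite /sg1 /= /upd eqxx sem_frame.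
  have l1 : regs sg1 l = L.
    by rewrite /sg1 /= /upd (negbTE lr) sem_frame.
  have [||||t2 [s3 [x3 T3 h3]]] := IHm s2 sg1 a2.
  + have -> : regs s2 K = regs s2 l - regs s2 r.
      by rewrite /s2 /= /upd !(eqxx, nK, ltn_eqF lK).
    case: a2 => ha _; rewrite !ha // l1 r1; lia.
  + by rewrite r1 addSnnS.
  + move=> r' r'l; rewrite /sg1 /= /upd; have := f r' r'l.
    rewrite inE negb_or => /andP[/negbTE -> r'b].
    by rewrite sem_frame // hl.
  + by [].
  exists ((t1 + (1 + (1 + 1))) + t2).+1, s3; split; last by rewrite iterSr.
  + apply: ExecWhileTrue x3; first by rewrite hK.
    by apply: ExecSeq x1 _; apply: ExecSeq; [|apply: ExecSeq]; apply: ExecInstr.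
  + by move: T1 T3; lia.
Qed.

(** * Weighted bipartite graphs with acyclic support *)

Section WeightedBipartite.
Variables (L : finType) (color : L -> bool).
Implicit Types (y : L -> L -> nat) (l : L) (c : seq L).

Definition bipartite y : Prop :=
  (forall l l', y l l' = y l' l) /\
  (forall l l', color l = color l' -> y l l' = 0).

Definition deg y l : nat := \sum_l' y l l'.

Definition sqsum y : nat := \sum_l \sum_l' y l l' ^ 2.

Definition edge y : rel L := fun l l' => 0 < y l l'.

(** A symmetric relation turns each edge into a cycle of length 2, hence the bound. *)
Definition acyclic (e : rel L) : Prop :=
  forall c, uniq c -> cycle e c -> size c <= 2.

(* The edges of the cycle [c] leaving (for [b = true]) the vertices of color
   [true] or entering them (for [b = false]). *)
Definition cycle_half c (b : bool) l l' : bool :=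
  (l \in c) && (l' == if color l == b then next c l else prev c l).

Lemma deg_cycle_half c b l : \sum_l' (cycle_half c b l l' : nat) = (l \in c).
Proof.
rewrite /cycle_half; case: (l \in c); last by rewrite big1.
by rewrite -big_mkcond /= sum1_card card1.
Qed.

Lemma cycle_half_edge y c b l l' :
  bipartite y -> cycle (edge y) c -> cycle_half c b l l' -> edge y l l'.
Proof.
move=> [ys _] cy /andP[lc /eqP ->]; case: ifP => _; first exact: (next_cycle cy lc).
by rewrite /edge ys; exact: (prev_cycle cy lc).
Qed.

(** Colors alternate along the cycle: the successor of a vertex has the other color and looks back
    to it as its predecessor. So each half is a perfect matching of the cycle. *)
Lemma cycle_half_sym y c b l l' : bipartite y -> uniq c -> cycle (edge y) c ->
  cycle_half c b l l' = cycle_half c b l' l.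
Proof.
move=> yb uc cy; suff imp l1 l2 : cycle_half c b l1 l2 -> cycle_half c b l2 l1.
  by apply/idP/idP; apply: imp.
move=> h; have e12 := cycle_half_edge yb cy h.
have c12 : (color l2 == b) = ~~ (color l1 == b).
  have : color l1 != color l2.
    by apply: contraTneq e12 => e; rewrite /edge (proj2 yb).
  by move: (color l1) (color l2) (b) => [] [] [].
move: h => /andP[lc]; rewrite /cycle_half c12.
case: ifP => _ /eqP -> /=; first by rewrite mem_next lc prev_next ?eqxx.
by rewrite mem_prev lc next_prev ?eqxx.
Qed.

Lemma cycle_improve y c : bipartite y -> uniq c -> cycle (edge y) c ->
  2 < size c ->
  exists y', [/\ bipartite y', deg y' =1 deg y & sqsum y < sqsum y'].
Proof.
move=> yb uc cy sc.
pose P := cycle_half c true; pose M := cycle_half c false.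
pose shift (A B : L -> L -> bool) l l' := y l l' + A l l' - B l l'.
have le1 b l l' : (cycle_half c b l l' : nat) <= y l l'.
  by case h: (cycle_half c b l l') => //=; have := cycle_half_edge yb cy h.
have shiftb b : bipartite (shift (cycle_half c b) (cycle_half c (~~ b))).
  split=> l l'; rewrite /shift.
    by rewrite !(@cycle_half_sym y c _ l l') // (proj1 yb l l').
  move=> e; have y0 := proj2 yb l l' e.
  by have := le1 b l l'; have := le1 (~~ b) l l'; rewrite y0; lia.
have shiftd b : deg (shift (cycle_half c b) (cycle_half c (~~ b))) =1 deg y.
  move=> l; rewrite /deg /shift; apply: (@addIn (l \in c)).
  rewrite -{1}(deg_cycle_half c (~~ b)) -(deg_cycle_half c b) -!big_split /=.
  by apply: eq_bigr => l' _; rewrite subnK // (leq_trans (le1 _ _ _)) ?leq_addr.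
(* On a cycle of length at least 3 the first vertex has distinct successor and predecessor, so the
   two halves differ there. *)
have [l0 [l1 d01]] : exists l l', P l l' != M l l'.
  case: c uc cy sc @P @M {shiftb shiftd le1} => [|a [|b [|d c]]] // uc cy _ P M.
  have na : next [:: a, b, d & c] a = b by rewrite /= eqxx.
  have pa : prev [:: a, b, d & c] a = last d c.
    rewrite /=; move: uc => /= /and3P[].
    rewrite !inE !negb_or => /and3P[/negbTE -> /negbTE nda nca] _ _.
    rewrite nda; elim: c d nda nca {na cy P M} => //= [|x c IH] d nda.
      by rewrite eqxx.
    rewrite inE negb_or => /andP[nax nac]; rewrite (negbTE nax).
    exact: (IH x (negbTE nax) nac).
  have ld : b != last d c.
    move: uc => /= /and4P[_ + _ _]; apply: contraNneq => ->.
    exact: mem_last.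
  exists a, b; rewrite /P /M /cycle_half na pa inE eqxx /=.
  by case: (color a) => /=; rewrite eqxx (negbTE ld).
(* Strict convexity, [(y + 1)^2 + (y - 1)^2 = 2 y^2 + 2], at each entry lying in exactly one
   half. *)
have conv : 2 * sqsum y < sqsum (shift P M) + sqsum (shift M P).
  rewrite /sqsum -big_split big_distrr /=.
  have pt l l' : 2 * y l l' ^ 2 + 2 * (P l l' != M l l') <=
      shift P M l l' ^ 2 + shift M P l l' ^ 2.
    rewrite /shift; have := le1 true l l'; have := le1 false l l'.
    rewrite -/P -/M -!mulnn; case: (P l l'); case: (M l l') => //=; try nia.
  rewrite (bigD1 l0) //= [X in _ < X](bigD1 l0) //= -addSn.
  apply: leq_add; last first.
    apply: leq_sum => l _; rewrite -big_split big_distrr /=.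
    by apply: leq_sum => l' _; have := pt l l'; lia.
  rewrite -big_split big_distrr /= (bigD1 l1) //= [X in _ < X](bigD1 l1) //= -addSn.
  apply: leq_add; first by have := pt l0 l1; rewrite d01; lia.
  by apply: leq_sum => l' _; have := pt l0 l'; lia.
have [h|h] : sqsum y < sqsum (shift P M) \/ sqsum y < sqsum (shift M P) by lia.
  by exists (shift P M); split=> //; [exact: (shiftb true) | exact: (shiftd true)].
by exists (shift M P); split=> //; [exact: (shiftb false) | exact: (shiftd false)].
Qed.

(** Bounds the potential: [cycle_improve] raises [sqsum] and keeps the degrees, so repeating it
    terminates. *)
Lemma sqsum_le_deg y : sqsum y <= \sum_l deg y l ^ 2.
Proof.
apply: leq_sum => l _; rewrite -[X in _ <= X]mulnn {1}/deg big_distrl /=.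
apply: leq_sum => l' _; rewrite -mulnn leq_mul2l.
by rewrite /deg (bigD1 l') //= leq_addr orbT.
Qed.

Lemma acyclic_reduction y : bipartite y ->
  exists y', [/\ bipartite y', deg y' =1 deg y, sqsum y <= sqsum y' &
                 acyclic (edge y')].
Proof.
have [m] := ubnP (\sum_l deg y l ^ 2 - sqsum y).
elim: m y => // m IHm y hm yb.
have [ac|nac] := classic (acyclic (edge y)); first by exists y; split.
have [c [uc cy sc]] : exists c, [/\ uniq c, cycle (edge y) c & 2 < size c].
  apply: NNPP => nc; apply: nac => c uc cy; rewrite leqNgt.
  by apply/negP => sc; apply: nc; exists c.
have [y1 [b1 d1 s1]] := cycle_improve yb uc cy sc.
have [|//|y2 [b2 d2 s2 a2]] := IHm y1.
  have e : \sum_l deg y1 l ^ 2 = \sum_l deg y l ^ 2.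
    by apply: eq_bigr => l _; rewrite d1.
  by have := sqsum_le_deg y1; rewrite e; move: hm s1; lia.
exists y2; split=> //; last by apply: leq_trans s2; apply: ltnW.
by move=> l; rewrite d2 d1.
Qed.

(* If every non-isolated vertex had two neighbours, a path could be prolonged
   forever without ever closing a cycle. *)
Lemma acyclic_leaf y : bipartite y -> acyclic (edge y) ->
  (exists l l', 0 < y l l') ->
  exists l l', 0 < y l l' /\ forall l'', l'' != l' -> y l l'' = 0.
Proof.
move=> yb ac [a0 [b0 ab]]; apply: NNPP => nl.
have ysym := proj1 yb.
have irr l : edge y l l = false by rewrite /edge (proj2 yb).
have step l l' : 0 < y l l' -> exists2 l'', l'' != l' & 0 < y l l''.
  move=> h; apply: NNPP => nx; apply: nl; exists l, l'; split=> // l'' n.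
  by apply/eqP; rewrite -leqn0 leqNgt; apply/negP=> h''; apply: nx; exists l''.
suff long m : exists x z p, [/\ path (edge y) x (z :: p), uniq (x :: z :: p) &
    m <= size p].
  have [x [z [p [_ up mp]]]] := long #|L|.
  have := leq_trans (max_card (mem (x :: z :: p))) mp.
  by rewrite (card_uniqP up) /= ltnNge leqnSn.
elim: m => [|m [x [z [p [pp up mp]]]]].
  exists a0, b0, [::]; split=> //=; rewrite ?/edge ?ab // inE andbT.
  by apply: contraTneq ab => ->; rewrite -leqNgt (proj2 yb).
move: (pp) => /= /andP[exz pz].
have [w wz xw] := step x z exz.
have wx : w != x by apply: contraTneq xw => ->; rewrite -/(edge y x x) irr.
have ewx : edge y w x by rewrite /edge ysym.
have [wp|wp] := boolP (w \in p); last first.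
  exists w, x, (z :: p); split=> //=; first by rewrite ewx exz.
  move: up => /= ->; rewrite !inE !negb_or wx wz wp.
  by [].
exfalso; case/splitPr: wp pp up {pz mp} => p1 p2 pp up.
have /ac : uniq (x :: z :: rcons p1 w).
  by move: up; rewrite -cat_rcons -!cat_cons cat_uniq => /andP[].
suff cy : cycle (edge y) (x :: z :: rcons p1 w).
  by move/(_ cy); rewrite /= size_rcons.
move: pp; rewrite -cat_rcons -cat_cons cat_path => /andP[pp _].
by rewrite /cycle rcons_path pp /= last_rcons.
Qed.

(* First child / next sibling representation of an ordered forest; [FNode l w ch
   sib] is a node [l] joined to its parent by an edge of weight [w]. *)
Inductive forest := FNil | FNode of L & nat & forest & forest.

Fixpoint labels F : seq L :=
  if F is FNode l _ ch sib then l :: labels ch ++ labels sib else [::].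

Fixpoint root_weight F : nat :=
  if F is FNode _ w _ sib then w + root_weight sib else 0.

(* The sum of the products of the weights of adjacent edges, for a forest hung
   below a node whose earlier edges have total weight [s]. *)
Fixpoint forest_cost F (s : nat) : nat :=
  if F is FNode _ w ch sib
  then w * s + forest_cost ch w + forest_cost sib (s + w) else 0.

Fixpoint node_sums (S : L -> nat) F : Prop :=
  if F is FNode l w ch sib
  then [/\ w + root_weight ch = S l, node_sums S ch & node_sums S sib]
  else True.

Fixpoint alternating b F : bool :=
  if F is FNode l _ ch sib
  then [&& color l == b, alternating (~~ b) ch & alternating b sib] else true.

Fixpoint add_leaf (u v : L) (w : nat) F : forest :=
  if F is FNode l w0 ch sib
  then if l == u then FNode l w0 (FNode v w FNil ch) sib
       else FNode l w0 (add_leaf u v w ch) (add_leaf u v w sib)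
  else FNil.

(** Extra weight [t] in front of the forest meets every root edge once and no other edge. *)
Lemma forest_costD F s t :
  forest_cost F (s + t) = forest_cost F s + t * root_weight F.
Proof.
elim: F s => [|l w ch _ sib IH] s /=; first by rewrite muln0.
by rewrite [s + t + w]addnAC IH; lia.
Qed.

Lemma add_leaf_notin u v w F : u \notin labels F -> add_leaf u v w F = F.
Proof.
elim: F => //= l w0 ch IHc sib IHs.
rewrite inE mem_cat !negb_or eq_sym => /and3P[/negbTE -> uc us].
by rewrite IHc ?IHs.
Qed.

Lemma node_sums_eq S S' F : {in labels F, S =1 S'} ->
  node_sums S F -> node_sums S' F.
Proof.
elim: F => //= l w ch IHc sib IHs e [e1 h1 h2]; split.
- by rewrite -e // mem_head.
- by apply: IHc h1 => x xc; apply: e; rewrite inE mem_cat xc !orbT.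
- by apply: IHs h2 => x xc; apply: e; rewrite inE mem_cat xc !orbT.
Qed.

Lemma root_weight_add_leaf u v w F :
  root_weight (add_leaf u v w F) = root_weight F.
Proof. by elim: F => //= l w0 ch _ sib IH; case: ifP => _ //=; rewrite IH. Qed.

Lemma alternating_add_leaf b u v w F : color v = ~~ color u ->
  alternating b F -> alternating b (add_leaf u v w F).
Proof.
move=> cv; elim: F b => //= l w0 ch IHc sib IHs b /and3P[/eqP cl ac as_].
case: ifP => [/eqP lu|_] /=; last by rewrite cl eqxx IHc ?IHs.
by rewrite cl cv -lu cl !eqxx ac as_.
Qed.

Lemma labels_add_leaf u v w F : uniq (labels F) -> u \in labels F ->
  perm_eq (labels (add_leaf u v w F)) (v :: labels F).
Proof.
elim: F => //= l w0 ch IHc sib IHs /andP[lcs ucs].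
rewrite inE mem_cat eq_sym; case: ifP => [_ _|_ /=] /=.
  by rewrite (perm_catCA [:: l] [:: v]).
move: ucs; rewrite cat_uniq => /and3P[uc /hasPn dj us].
rewrite (perm_sym _ (v :: _)) (perm_catCA [:: v] [:: l]) perm_cons perm_sym /=.
case/orP=> h.
  rewrite (add_leaf_notin _ _ (F := sib)); first by rewrite -cat_cons perm_cat2r IHc.
  by apply: contraL h => /dj.
rewrite (add_leaf_notin _ _ (F := ch)); last by apply: dj.
rewrite -(cat1s v) perm_sym perm_catCA perm_cat2l cat1s perm_sym.
exact: IHs.
Qed.

(** The new edge meets exactly the edges already at [u], and these have total weight [S u]. *)
Lemma cost_add_leaf S u v w F s : uniq (labels F) -> u \in labels F ->
  node_sums S F ->
  forest_cost (add_leaf u v w F) s = forest_cost F s + w * S u.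
Proof.
elim: F s => //= l w0 ch IHc sib IHs s /andP[lcs ucs].
rewrite inE mem_cat eq_sym => + [sl hc hs]; case: ifP => [/eqP <- _|_ /=] /=.
  by rewrite !addn0 forest_costD -sl; lia.
move: ucs; rewrite cat_uniq => /and3P[uc /hasPn dj us].
case/orP=> h.
  rewrite (add_leaf_notin _ _ (F := sib)); first by rewrite IHc //; lia.
  by apply: contraL h => /dj.
rewrite (add_leaf_notin _ _ (F := ch)); last by apply: dj.
by rewrite IHs //; lia.
Qed.

Lemma node_sums_add_leaf S S' u v w F : uniq (labels F) -> u \in labels F ->
  v \notin labels F -> S' u = S u + w -> S' v = w ->
  (forall l, l != u -> l != v -> S' l = S l) ->
  node_sums S F -> node_sums S' (add_leaf u v w F).
Proof.
move=> uF uI vI Su Sv So.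
have keep F' : u \notin labels F' -> v \notin labels F' ->
    node_sums S F' -> node_sums S' F'.
  move=> nu nv; apply: node_sums_eq => x xF; rewrite So //.
    by apply: contraNneq nu => <-.
  by apply: contraNneq nv => <-.
elim: F uF uI vI => //= l w0 ch IHc sib IHs /andP[lcs ucs].
rewrite !inE !mem_cat eq_sym !negb_or => + /and3P[vl vc vs] [sl hc hs].
move: ucs lcs; rewrite cat_uniq mem_cat negb_or => /and3P[uc /hasPn dj us].
case/andP=> lc ls; case: ifP => [/eqP lu _|/negbT lu /=] /=.
  subst l; split; [by rewrite Su -sl -addnA [w + _]addnC| |exact: keep].
  by split=> //; [rewrite Sv addn0 | apply: keep].
case/orP=> h.
  have nus : u \notin labels sib by apply: contraL h => /dj.
  rewrite (add_leaf_notin _ _ nus); split; last exact: keep.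
    by rewrite root_weight_add_leaf sl So // eq_sym.
  exact: IHc.
have nuc : u \notin labels ch by apply: dj.
rewrite (add_leaf_notin _ _ nuc); split; [|exact: keep|exact: IHs].
by rewrite sl So // eq_sym.
Qed.

(** Induction on removing a leaf edge. The identity expands each [deg y l ^ 2] into the squares of
    the weights at [l] and twice the products of pairs of edges meeting at [l]; [sqsum] counts each
    square at both ends. *)
Lemma acyclic_forest y : bipartite y -> acyclic (edge y) ->
  exists F, [/\ uniq (labels F), labels F =i [pred l | 0 < deg y l],
    node_sums (deg y) F, alternating true F &
    root_weight F = 0 /\
    2 * forest_cost F 0 + sqsum y = \sum_l deg y l ^ 2].
Proof.
have [m] := ubnP (sqsum y); elim: m y => // m IHm y hm yb ac.
have [nz|z] := classic (exists l l', 0 < y l l'); last first.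
  have y0 l l' : y l l' = 0.
    by apply/eqP; rewrite -leqn0 leqNgt; apply/negP=> h; apply: z; exists l, l'.
  have d0 l : deg y l = 0 by rewrite /deg big1.
  exists FNil; split=> //=; first by move=> l; rewrite !inE d0.
  split=> //; rewrite /sqsum !big1 // => l _; first by rewrite d0.
  by rewrite big1 // => l' _; rewrite y0.
have [v [u [w0 leaf]]] := acyclic_leaf yb ac nz; set w := y v u in w0.
have cuv : color v = ~~ color u.
  case E: (color v); case E': (color u) => //=; move: w0;
  by rewrite /w (proj2 yb) ?E ?E'.
have uv : u != v by apply: contraTneq isT => e; move: cuv; rewrite e; case: color.
pose y0 l l' := if ((l == v) && (l' == u)) || ((l == u) && (l' == v)) then 0
  else y l l'.
(* Used with [id] for the degrees and with squaring for [sqsum]. *)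
have ysplit (g : nat -> nat) l l' : g 0 = 0 -> g (y l l') =
    g (y0 l l') + g w * ((l == v) && (l' == u)) + g w * ((l == u) && (l' == v)).
  rewrite /y0 => g0; have [->|nv] := eqVneq l v.
    rewrite [v == u]eq_sym (negbTE uv) /= orbF muln0 addn0.
    by case: eqP => [->|_] /=; rewrite ?g0 ?muln1 // muln0 addn0.
  have [->|nu] := eqVneq l u; rewrite /= ?muln0 ?addn0 //.
  by case: eqP => [->|_] /=; rewrite ?muln0 ?addn0 // muln1 g0 (proj1 yb).
have pick1 x (a b : L) l : \sum_l' x * ((l == a) && (l' == b)) = x * (l == a).
  rewrite -big_distrr /=; congr (_ * _); rewrite (bigD1 b) //= eqxx andbT.
  by rewrite big1 ?addn0 // => i /negbTE ->; rewrite andbF.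
have pick2 x (a : L) : \sum_l x * (l == a) = x.
  rewrite (bigD1 a) //= eqxx muln1 big1 ?addn0 // => i /negbTE ->.
  by rewrite muln0.
have dy l : deg y l = deg y0 l + w * (l == v) + w * (l == u).
  rewrite /deg (eq_bigr _ (fun l' _ => ysplit id l l' erefl)) !big_split /=.
  by rewrite !pick1.
have sy : sqsum y = sqsum y0 + 2 * w ^ 2.
  rewrite /sqsum (eq_bigr (fun l => \sum_l' y0 l l' ^ 2 + w ^ 2 * (l == v)
    + w ^ 2 * (l == u))) => [|l _].
    by rewrite !big_split /= !pick2; lia.
  rewrite (eq_bigr _ (fun l' _ => ysplit (expn^~ 2) l l' erefl)) !big_split /=.
  by rewrite !pick1.
have y0v : deg y0 v = 0.
  rewrite /deg big1 // => l _; rewrite /y0 eqxx /= [v == u]eq_sym (negbTE uv).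
  by rewrite orbF; case: eqP => // /eqP; apply: leaf.
have w2 : 0 < w ^ 2 by rewrite expn_gt0 w0.
have y0b : bipartite y0.
  split=> l l'; rewrite /y0; last by move=> /(proj2 yb) ->; case: ifP.
  by rewrite orbC (proj1 yb) [(l == v) && _]andbC [(l == u) && _]andbC.
have y0ac : acyclic (edge y0).
  move=> c uc cc; apply: (ac c uc); apply: sub_cycle cc => l l'.
  by rewrite /edge /y0; case: ifP.
have [|F [uF lF nF aF [rF cF]]] := IHm y0 _ y0b y0ac; first by move: hm; lia.
have vF : v \notin labels F by rewrite lF inE y0v.
have dsq : \sum_l deg y l ^ 2 =
    \sum_l deg y0 l ^ 2 + (2 * w ^ 2 + 2 * w * deg y0 u).
  have dsq1 l : deg y l ^ 2 = deg y0 l ^ 2 + w ^ 2 * (l == v)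
    + (w ^ 2 + 2 * w * deg y0 u) * (l == u).
    rewrite dy; have [->|nv] := eqVneq l v.
      by rewrite y0v [v == u]eq_sym (negbTE uv); lia.
    by have [->|nu] := eqVneq l u; rewrite -!mulnn; lia.
  by rewrite (eq_bigr _ (fun l _ => dsq1 l)) !big_split /= !pick2; lia.
(* The labels are the vertices of positive degree, so [u] is a node already exactly when it keeps
   another edge; then [v] becomes its child. *)
have [uI|uI] := boolP (u \in labels F).
  exists (add_leaf u v w F); have pl := labels_add_leaf v w uF uI; split.
  - by rewrite (perm_uniq pl) /= vF uF.
  - move=> l; rewrite (perm_mem pl) inE lF !inE dy.
    have [->|_] /= := eqVneq l v; first by rewrite !addn_gt0 muln1 w0 orbT.
    have [e|_] := eqVneq l u; last by lia.
    by move: uI; rewrite lF inE e; lia.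
  - apply: (node_sums_add_leaf uF uI vF) nF.
    + by rewrite dy eqxx (negbTE uv); lia.
    + by rewrite dy eqxx y0v [v == u]eq_sym (negbTE uv); lia.
    + by move=> l /negbTE nu /negbTE nv; rewrite dy nu nv !muln0 !addn0.
  - exact: alternating_add_leaf.
  - rewrite root_weight_add_leaf; split=> //.
    by rewrite (cost_add_leaf _ _ _ uF uI nF) sy dsq; move: cF; lia.
have y0u : deg y0 u = 0 by apply/eqP; move: uI; rewrite lF inE -leqNgt leqn0.
pose r := if color v then v else u; pose c := if color v then u else v.
(* Here the edge is a whole tree. It is rooted at its end of color [true], which hangs from the
   dummy by an edge of weight 0. *)
have [cr cc] : color r = true /\ color c = false.
  by rewrite /r /c cuv; case E: (color u) => /=; rewrite ?E ?cuv ?E.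
have rc l : (l == r) + (l == c) = (l == v) + (l == u).
  by rewrite /r /c; case: (color v); rewrite // addnC.
have nrc : r != c by rewrite /r /c; case: (color v); rewrite // eq_sym.
have [rF' cF'] : r \notin labels F /\ c \notin labels F.
  by rewrite /r /c; case: (color v).
have d0 l : (l == r) || (l == c) -> deg y l = w.
  move=> h; have h2 : (l == v) + (l == u) = 1.
    rewrite -rc; case/orP: h => /eqP ->; rewrite eqxx.
      by rewrite (negbTE nrc).
    by rewrite eq_sym (negbTE nrc).
  rewrite dy; have -> : deg y0 l = 0.
    have [->|nv] := eqVneq l v; first by [].
    have [->|nu] := eqVneq l u; first by [].
    by move: h2; rewrite (negbTE nv) (negbTE nu).
  by rewrite -addnA -mulnDr h2 muln1.
exists (FNode r 0 (FNode c w FNil FNil) F); split=> /=.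
- by rewrite inE negb_or nrc rF' cF' uF.
- move=> l; rewrite !inE lF inE orbA.
  case: (boolP ((l == r) || (l == c))) => [h|]; first by rewrite d0.
  rewrite negb_or => /andP[/negbTE h1 /negbTE h2].
  rewrite dy; move: (rc l); rewrite h1 h2; case: (l == v); case: (l == u) => //= _.
  by rewrite !muln0 !addn0.
- rewrite !d0 ?eqxx ?orbT //; split; [by rewrite addn0 | by rewrite addn0 |].
  apply: node_sums_eq nF => l; rewrite lF inE dy => h.
  have [e|_] := eqVneq l v; first by move: h; rewrite e y0v.
  have [e|_] := eqVneq l u; first by move: h; rewrite e y0u.
  by rewrite !muln0 !addn0.
- by rewrite cr cc aF.
- by rewrite rF; split=> //; rewrite !muln0 !addn0 sy dsq y0u addnA cF !muln0 addn0.
Qed.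

End WeightedBipartite.

(** * Cluster graphs as labelings *)

Section EdgeSets.
Variable T : finType.
Implicit Types (A B C E X : {set {set T}}) (e : {set T}) (x y : T).

Lemma in_symdiff A B e : (e \in symdiff A B) = (e \in A) (+) (e \in B).
Proof. by rewrite !inE; case: (e \in A); case: (e \in B). Qed.

Lemma symdiffK A B : symdiff A (symdiff A B) = B.
Proof. by apply/setP=> e; rewrite !in_symdiff addKb. Qed.

Lemma symdiff_pairs A B : A \subset pairs T -> B \subset pairs T ->
  symdiff A B \subset pairs T.
Proof.
move=> /subsetP Ap /subsetP Bp; apply/subsetP=> e; rewrite in_symdiff.
by case: (boolP (e \in A)) => [/Ap //|_ /Bp].
Qed.

Lemma symdiff_triangle A B C :
  #|symdiff A C| <= #|symdiff A B| + #|symdiff B C|.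
Proof.
apply: leq_trans (leq_card_setU _ _); apply: subset_leq_card.
apply/subsetP=> e; rewrite in_setU !in_symdiff.
by case: (e \in A); case: (e \in B); case: (e \in C).
Qed.

Lemma symdiff_flip A B E e : (forall e', e' != e -> (e' \in B) = (e' \in A)) ->
  e \in symdiff A E -> e \notin symdiff B E ->
  #|symdiff A E| = #|symdiff B E|.+1.
Proof.
move=> h eA eB; rewrite (cardsD1 e) eA add1n; congr _.+1; apply: eq_card => e'.
rewrite in_setD1 !in_symdiff; have [->|n] := eqVneq e' e; last by rewrite h.
by move: eB; rewrite in_symdiff => /negbTE ->.
Qed.

Lemma symdiff_flip_le A B E e : (forall e', e' != e -> (e' \in B) = (e' \in A)) ->
  #|symdiff E B| <= #|symdiff E A|.+1.
Proof.
move=> h; apply: (@leq_trans #|e |: symdiff E A|); last first.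
  by rewrite cardsU1; case: (_ \notin _).
apply: subset_leq_card; apply/subsetP=> e'; rewrite in_setU1 !in_symdiff.
by have [//|n] := eqVneq e' e; rewrite h.
Qed.

Lemma adjC E x y : adj E x y = adj E y x.
Proof. by rewrite /adj setUC. Qed.

Lemma pair2 x y : ([set x; y] \in pairs T) = (x != y).
Proof. by rewrite inE cards2; case: (x != y). Qed.

Lemma adjxx E x : E \subset pairs T -> adj E x x = false.
Proof.
by move=> /subsetP Ep; apply/negP => /Ep; rewrite pair2 eqxx.
Qed.

Lemma pairsP e : e \in pairs T -> exists x y, x != y /\ e = [set x; y].
Proof. by rewrite inE => /cards2P. Qed.

Lemma eq_adj A B : A \subset pairs T -> B \subset pairs T ->
  (forall x y, x != y -> adj A x y = adj B x y) -> A = B.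
Proof.
move=> /subsetP Ap /subsetP Bp h; apply/setP=> e.
apply/idP/idP=> he.
  have [x [y [n de]]] := pairsP (Ap _ he).
  by move: he; rewrite de -/(adj A x y) h.
have [x [y [n de]]] := pairsP (Bp _ he).
by move: he; rewrite de -/(adj B x y) -h.
Qed.

(** Double counting of the incidences between vertices and edges. *)
Lemma sum_adj X : X \subset pairs T ->
  \sum_x \sum_y (adj X x y : nat) = 2 * #|X|.
Proof.
move=> Xp; have -> : 2 * #|X| = \sum_(e in X) \sum_x (x \in e : nat).
  rewrite mulnC -sum_nat_const; apply: eq_bigr => e /(subsetP Xp).
  rewrite inE => /eqP <-; rewrite -sum1_card big_mkcond /=.
  by apply: eq_bigr => x _; case: (x \in e).
rewrite [RHS]exchange_big /=; apply: eq_bigr => x _.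
rewrite -big_mkcond /= sum1_card -big_mkcondr sum1_card /=.
rewrite -(@card_in_imset _ _ (fun y => [set x; y]) [pred y | adj X x y]).
  apply: eq_card => e; apply/imsetP/andP => [[y xy ->]|[eX xe]].
    by rewrite set21.
  have [a [b [n de]]] := pairsP (subsetP Xp _ eX).
  move: xe; rewrite de !inE => /orP[] /eqP xx; rewrite xx.
    by exists b; rewrite // inE /adj -de.
  by exists a; rewrite 1?setUC // inE /adj setUC -de.
move=> y z; rewrite !inE => xy xz /setP e.
have yx : y != x by apply: contraTneq xy => ->; rewrite adjxx.
by have := e y; rewrite !inE eqxx orbT (negbTE yx) /= => /esym/eqP.
Qed.

End EdgeSets.

Section LabelGraph.
Variables (T : finType) (L : eqType).
Implicit Types (E : {set {set T}}) (f : T -> L) (x y : T).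

Definition label_graph f : {set {set T}} :=
  [set e in pairs T | [forall x in e, forall y in e, f x == f y]].

Definition fiber f x : {set T} := [set y | f y == f x].

Lemma label_graph_pairs f : label_graph f \subset pairs T.
Proof. by apply/subsetP=> e; rewrite inE => /andP[]. Qed.

Lemma adj_label f x y : adj (label_graph f) x y = (x != y) && (f x == f y).
Proof.
rewrite /adj inE pair2; case: (x != y) => //=.
apply/forall_inP/eqP => [h|fxy z].
  by apply/eqP; have /forall_inP/(_ y) := h x (set21 _ _); apply; rewrite set22.
by rewrite !inE => h; apply/forall_inP=> w; rewrite !inE;
   case/orP: h => /eqP ->; case/orP => /eqP ->; rewrite ?fxy.
Qed.

Lemma component_label f x : component (label_graph f) x = fiber f x.
Proof.
apply/setP=> y; rewrite !inE; apply/idP/eqP => [/connectP[p + ->]|fyx].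
  elim: p x => //= z p IHp x /andP[+ /IHp ->].
  by rewrite adj_label => /andP[_ /eqP].
have [->|n] := eqVneq x y; first exact: connect0.
by apply: connect1; rewrite adj_label n fyx eqxx.
Qed.

Lemma label_graph_bce E f k eta lo : E \subset pairs T ->
  #|symdiff E (label_graph f)| <= k ->
  (forall x, lo <= #|fiber f x| <= lo + eta) ->
  balanced_cluster_editing E k eta.
Proof.
move=> Ep dk sz; apply/existsP; exists (symdiff E (label_graph f)).
rewrite symdiff_pairs ?label_graph_pairs // dk symdiffK /=; apply/andP; split.
  apply/forall_inP=> H /imsetP[x _ ->]; rewrite component_label.
  apply/forall_inP=> y; rewrite inE => /eqP yx.
  apply/forall_inP=> z; rewrite inE => /eqP zx.
  by apply/implyP=> n; rewrite adj_label n yx zx eqxx.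
apply/forall_inP=> H /imsetP[x _ ->]; apply/forall_inP=> H' /imsetP[y _ ->].
rewrite !component_label; have := sz x; have := sz y; lia.
Qed.

End LabelGraph.

Section Cluster.
Variable T : finType.
Implicit Types (E : {set {set T}}) (x y : T).

Lemma bce_label_graph E k eta : E \subset pairs T ->
  balanced_cluster_editing E k eta ->
  exists (f : T -> {set T}) (lo : nat),
    [/\ lo <= #|T|, #|symdiff E (label_graph f)| <= k &
        forall x, lo <= #|fiber f x| <= lo + eta].
Proof.
move=> Ep /existsP[F /and4P[Fp Fk cl bal]]; set E' := symdiff E F in cl bal.
have E'p : E' \subset pairs T by apply: symdiff_pairs.
pose f := component E'.
have csym : connect_sym (adj E').
  by apply: sym_connect_sym => x y; apply: adjC.
have fxy x y : (f x == f y) = connect (adj E') x y.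
  apply/eqP/idP => [/setP/(_ y)|h]; first by rewrite !inE connect0 => ->.
  by apply/setP=> z; rewrite !inE; apply: same_connect.
have fib x : fiber f x = f x.
  by apply/setP=> y; rewrite /f !inE fxy csym.
have lg : label_graph f = E'.
  apply: eq_adj => //; first exact: label_graph_pairs.
  move=> x y n; rewrite adj_label n fxy /=; apply/idP/idP=> h; last exact: connect1.
  have /forall_inP/(_ (component E' x)) := cl; rewrite imset_f // => /(_ isT).
  move=> /forall_inP/(_ x); rewrite inE connect0 => /(_ isT)/forall_inP/(_ y).
  by rewrite inE h n => /(_ isT).
have dF : #|symdiff E (label_graph f)| <= k by rewrite lg symdiffK.
exists f; have [x0 _|T0] := pickP T; last first.
  by exists 0; split=> // x; have := T0 x.
(* The smallest component size serves as [lo]; balance then bounds all others by [lo + eta]. *)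
have [x _ xmin] := arg_minnP (fun x => #|f x|) (erefl : xpredT x0).
exists #|f x|; split=> //; first exact: max_card.
move=> y; rewrite fib xmin //=.
have /forall_inP/(_ (f x)) := bal; rewrite imset_f // => /(_ isT).
by move=> /forall_inP/(_ (f y)); rewrite imset_f // => /(_ isT); lia.
Qed.

Lemma sum_label_dist (L1 L2 : eqType) (f : T -> L1) (g : T -> L2) :
  \sum_x \sum_y ((f x == f y) != (g x == g y) : nat) =
  2 * #|symdiff (label_graph f) (label_graph g)|.
Proof.
rewrite -sum_adj; last by apply: symdiff_pairs; apply: label_graph_pairs.
apply: eq_bigr => x _; apply: eq_bigr => y _.
rewrite /adj in_symdiff -!/(adj _ _ _) !adj_label.
have [->|_] := eqVneq x y; first by rewrite !eqxx.
by case: (f x == f y); case: (g x == g y).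
Qed.

Definition p3free E : Prop :=
  forall x y z, x != z -> adj E x y -> adj E y z -> adj E x z.

Lemma label_graph_p3free (L : eqType) (f : T -> L) : p3free (label_graph f).
Proof.
move=> x y z n; rewrite !adj_label n => /andP[_ /eqP ->] /andP[_ /eqP ->].
exact: eqxx.
Qed.

(** In a graph without induced paths on three vertices, closed neighbourhoods are the components.
    This labels vertices by component without connectivity, and makes component size equal to degree
    plus one. *)
Definition nbh E x : {set T} := x |: [set y | adj E x y].

Lemma eq_nbh E x y : E \subset pairs T -> p3free E ->
  (nbh E x == nbh E y) = (x == y) || adj E x y.
Proof.
move=> Ep p3; apply/eqP/orP => [/setP/(_ y)|[/eqP ->//|xy]].
  by rewrite !inE eqxx /= [y == x]eq_sym => /orP.
suff sub u v : adj E u v -> nbh E u \subset nbh E v.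
  by apply/eqP; rewrite eqEsubset !sub // adjC.
move=> uv; apply/subsetP=> z; rewrite !inE => /orP[/eqP ->|uz].
  by rewrite adjC uv orbT.
have [//|n] := eqVneq z v; rewrite /=; apply: (p3 _ u) => //; last by rewrite adjC.
by rewrite eq_sym.
Qed.

Lemma label_graph_nbh E : E \subset pairs T -> p3free E ->
  label_graph (nbh E) = E.
Proof.
move=> Ep p3; apply: eq_adj => // [|x y n]; first exact: label_graph_pairs.
by rewrite adj_label n eq_nbh // (negbTE n).
Qed.

Lemma card_fiber_nbh E x : E \subset pairs T -> p3free E ->
  #|fiber (nbh E) x| = #|[set y | adj E x y]|.+1.
Proof.
move=> Ep p3; transitivity #|nbh E x|; last first.
  by rewrite cardsU1 inE adjxx.
by apply: eq_card => y; rewrite !inE eq_nbh // adjC.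
Qed.

End Cluster.

(** * The stack machine *)

(* A configuration [(stk, N, c)] of the stack machine: [stk] lists, from the top,
   the open nodes with their current weight and the weight of the edge to their
   parent; [N s] is the number of vertices in components of size [s] that are
   still unused; [c] is the cost so far.  Nodes at odd height stand for old
   components, nodes at even height for new clusters; the bottom of the stack is
   a dummy. *)
Definition config : Type := (seq (nat * nat) * (nat -> nat) * nat)%type.

(* Tokens: [1] opens a node, [2] closes it, [3] moves one more vertex along the
   edge to the parent, anything else is ignored. *)
Definition mstep (n lo hi : nat) (st : option config) (tok : nat) :
    option config :=
  if st is Some (stk, N, c) then
    match tok with
    | 1 => Some ((0, 0) :: stk, N, c)
    | 2 => if stk is (s, _) :: (_ :: _) as rest then
             if odd (size rest)
             then if (s <= n) && (s <= N s)
                  then Some (rest, upd N s (N s - s), c) else None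
             else if lo <= s <= hi then Some (rest, N, c) else None
           else None
    | 3 => if stk is (s, x) :: (s', x') :: rest then
             Some ((s.+1, x.+1) :: (s'.+1, x') :: rest, N, c + (s + s' - 2 * x))
           else None
    | _ => st
    end
  else None.

Definition maccept (n lo hi k : nat) (st : option config) : bool :=
  if st is Some ([:: (0, _)], N, c) then
    (c <= k) && all (fun s => (N s == 0) || (lo <= s <= hi)) (iota 0 n.+1)
  else false.

Section Words.
Variables (L : finType) (color : L -> bool) (S : L -> nat) (n lo hi : nat).
Implicit Types (F : forest L).

Fixpoint word F : seq nat :=
  if F is FNode _ w ch sib
  then 1 :: nseq w 3 ++ word ch ++ 2 :: word sib else [::].

Lemma size_word F : node_sums S F ->
  size (word F) <= \sum_(l <- labels F) (S l + 2).
Proof.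
elim: F => [|l w ch IHc sib IHs] //= [sl /IHc hc /IHs hs].
rewrite !(size_cat, size_nseq) /= big_cons big_cat /= -sl; lia.
Qed.

Lemma all_word F : all (fun t => t < 4) (word F).
Proof.
elim: F => //= l w ch IHc sib IHs.
by rewrite !all_cat IHc /= IHs andbT; elim: w.
Qed.

(** As long as a node has no children its weight equals that of its parent edge, so a unit costs
    [t + p - 2 * t = p - t]. Each unit raises both [t] and [p] and leaves this difference
    unchanged. *)
Lemma run_units w t p x rest N c : t <= p ->
  foldl (mstep n lo hi) (Some ((t, t) :: (p, x) :: rest, N, c)) (nseq w 3) =
  Some ((t + w, t + w) :: (p + w, x) :: rest, N, c + w * (p - t)).
Proof.
elim: w t p c => [|w IHw] t p c tp /=; first by rewrite !addn0.
rewrite IHw // !addSnnS subSS; congr (Some (_, _, _)).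
have -> : t + p - 2 * t = p - t by lia.
by rewrite mulSn addnA.
Qed.

(** [N t] counts vertices, not components, so a component of size [t] demands [t]. *)
Definition demand F t := \sum_(l <- labels F | color l && (S l == t)) S l.

Lemma run_word F p x rest N c :
  alternating color (odd (size rest).+1) F -> node_sums S F ->
  {in labels F, forall l, ~~ color l -> lo <= S l <= hi} ->
  {in labels F, forall l, S l <= n} ->
  (forall t, demand F t <= N t) ->
  exists N', foldl (mstep n lo hi) (Some ((p, x) :: rest, N, c)) (word F) =
      Some ((p + root_weight F, x) :: rest, N', c + forest_cost F p) /\
    forall t, N' t = N t - demand F t.
Proof.
elim: F p x rest N c => [|l w ch IHc sib IHs] p x rest N c.
  move=> _ _ _ _ _; exists N; rewrite /= !addn0; split=> // t.
  by rewrite /demand big_nil subn0.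
move=> /= /and3P[/eqP cl ac as_] [sl nc ns] hcol hn hN.
have dE t : demand (FNode l w ch sib) t =
    (color l && (S l == t)) * S l + demand ch t + demand sib t.
  rewrite /demand /= big_cons big_cat /= -addnA.
  by case: ifP; rewrite ?mul1n ?mul0n.
have [||||N1 [e1 h1]] := IHc w w ((p + w, x) :: rest) N (c + w * p) _ nc.
- by rewrite /= negbK in ac *.
- by move=> l' hl; apply: hcol; rewrite inE mem_cat hl !orbT.
- by move=> l' hl; apply: hn; rewrite inE mem_cat hl !orbT.
- by move=> t; have := hN t; rewrite dE; lia.
pose N2 t := N1 t - (color l && (S l == t)) * S l.
have step : exists N3, mstep n lo hi
     (Some ((S l, w) :: (p + w, x) :: rest, N1, c + w * p + forest_cost ch w)) 2 =
     Some ((p + w, x) :: rest, N3, c + w * p + forest_cost ch w) /\ N3 =1 N2.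
  rewrite /mstep /= -cl; case: (boolP (color l)) => [cl1|cl0]; last first.
    rewrite hcol ?mem_head //; exists N1; split=> // t.
    by rewrite /N2 (negbTE cl0) subn0.
  rewrite hn ?mem_head //= h1.
  have -> : S l <= N (S l) - demand ch (S l).
    by have := hN (S l); rewrite dE cl1 eqxx; lia.
  eexists; split; first by [].
  move=> t; rewrite /N2 /upd cl1 [t == _]eq_sym /=; case: eqP => [<-|_].
    by rewrite mul1n h1.
  by rewrite subn0.
have [N3 [e3 h3]] := step.
have [|||N4 [e4 h4]] := IHs (p + w) x rest N3 (c + w * p + forest_cost ch w) as_ ns.
- by move=> l' hl; apply: hcol; rewrite inE mem_cat hl !orbT.
- by move=> l' hl; apply: hn; rewrite inE mem_cat hl !orbT.
- by move=> t; have := hN t; rewrite h3 /N2 h1 dE; lia.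
exists N4; split; last first.
  by move=> t; rewrite h4 h3 /N2 h1 dE; lia.
rewrite /= foldl_cat /mstep -/(mstep n lo hi) run_units // subn0 add0n.
rewrite foldl_cat e1 sl; move: e3; rewrite /= => ->.
by rewrite e4 !addnA.
Qed.

End Words.

(** * From an editing to an accepted word *)

Definition unused (V : finType) (G : eqType) (g : V -> G) (s : nat) : nat :=
  #|[set v | #|fiber g v| == s]|.

Section Table.
Variables (V A B : finType) (g : V -> A) (f : V -> B).
Implicit Types (v w : V).

Definition touched : {set V} := [set v | fiber g v != fiber f v].

(** Stored symmetrically on the disjoint sum: each entry counts twice in [sqsum], each touched
    vertex twice in the degree sum. *)
Definition table (l l' : A + B) : nat :=
  match l, l' with
  | inl a, inr b | inr b, inl a =>
      #|[set v in touched | (g v == a) && (f v == b)]|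
  | _, _ => 0
  end.

Definition is_inl (l : A + B) : bool := if l is inl _ then true else false.

Lemma table_bipartite : bipartite is_inl table.
Proof. by split=> [[a|b] [a'|b']|[a|b] [a'|b']]. Qed.

(** If one vertex has the same fiber under [g] and [f], so does every vertex of that fiber. Hence
    [touched] is a union of old components, and likewise of new clusters, and the degrees in the
    table are their full sizes. *)
Lemma touched_g v w : v \in touched -> g w = g v -> w \in touched.
Proof.
rewrite !inE => + gw; apply: contraNneq => e.
have fgw : fiber g w = fiber g v by apply/setP=> x; rewrite !inE gw.
have : v \in fiber f w by rewrite -e inE gw.
rewrite inE => /eqP fv; rewrite -fgw e.
by apply/eqP/setP=> x; rewrite !inE fv.
Qed.

Lemma touched_f v w : v \in touched -> f w = f v -> w \in touched.
Proof.
rewrite !inE => + fw; apply: contraNneq => e.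
have ffw : fiber f w = fiber f v by apply/setP=> x; rewrite !inE fw.
have : v \in fiber g w by rewrite e inE fw.
rewrite inE => /eqP gv; rewrite -ffw -e.
by apply/eqP/setP=> x; rewrite !inE gv.
Qed.

Lemma deg_table_inl a : deg table (inl a) = #|[set v in touched | g v == a]|.
Proof.
rewrite /deg big_sumType /= big1 // add0n -sum1dep_card.
rewrite (partition_big f xpredT) //=; apply: eq_bigr => b _.
by rewrite -sum1dep_card; apply: eq_bigl => v; rewrite andbA.
Qed.

Lemma deg_table_inr b : deg table (inr b) = #|[set v in touched | f v == b]|.
Proof.
rewrite /deg big_sumType /= [X in _ + X]big1 // addn0 -sum1dep_card.
rewrite (partition_big g xpredT) //=; apply: eq_bigr => a _.
by rewrite -sum1dep_card; apply: eq_bigl => v; rewrite -andbA [X in _ && X]andbC.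
Qed.

Lemma deg_table_g v : v \in touched -> deg table (inl (g v)) = #|fiber g v|.
Proof.
move=> vt; rewrite deg_table_inl; apply: eq_card => w; rewrite in_set [RHS]in_set.
by have [/(touched_g vt) ->|] := eqVneq (g w) (g v); rewrite ?andbF.
Qed.

Lemma deg_table_f v : v \in touched -> deg table (inr (f v)) = #|fiber f v|.
Proof.
move=> vt; rewrite deg_table_inr; apply: eq_card => w; rewrite in_set [RHS]in_set.
by have [/(touched_f vt) ->|] := eqVneq (f w) (f v); rewrite ?andbF.
Qed.

Lemma sum_deg_table : \sum_l deg table l = 2 * #|touched|.
Proof.
rewrite big_sumType /= mul2n -addnn; congr (_ + _).
  rewrite -sum1_card (partition_big g xpredT) //=; apply: eq_bigr => a _.
  by rewrite deg_table_inl -sum1dep_card.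
rewrite -sum1_card (partition_big f xpredT) //=; apply: eq_bigr => a _.
by rewrite deg_table_inr -sum1dep_card.
Qed.

Lemma sum_eq_sq (C : finType) (h : V -> C) (U : {set V}) :
  \sum_(v in U) \sum_(w in U) (h v == h w : nat) =
  \sum_c #|[set v in U | h v == c]| ^ 2.
Proof.
rewrite (partition_big h xpredT) //=; apply: eq_bigr => c _.
rewrite -mulnn -{1}sum1dep_card big_distrl /=; apply: eq_bigr => v /andP[_ /eqP hv].
rewrite mul1n -sum1dep_card big_mkcondr /=; apply: eq_bigr => w _.
by rewrite hv eq_sym; case: (_ == _).
Qed.

Definition disagree : nat :=
  \sum_v \sum_w ((g v == g w) != (f v == f w) : nat).

Lemma card_touched : #|touched| <= disagree.
Proof.
rewrite -sum1_card big_mkcond; apply: leq_sum => v _; case: ifP => // vt.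
have [w hw] : exists w, (g v == g w) != (f v == f w).
  apply/existsP; move: vt; rewrite inE; apply: contraNT => /existsPn h.
  apply/eqP/setP=> w; rewrite !inE; have := h w; rewrite negbK => /eqP.
  by rewrite [g v == _]eq_sym [f v == _]eq_sym.
by rewrite (bigD1 w) //= hw.
Qed.

(** The left side counts ordered touched pairs with equal [g], plus those with equal [f];
    [sqsum table] is twice the number with both equal. The difference counts pairs with exactly one
    equality. *)
Lemma deg_table_sq : \sum_l deg table l ^ 2 <= disagree + sqsum table.
Proof.
have sqE : sqsum table =
    2 * \sum_(v in touched) \sum_(w in touched) ((g v, f v) == (g w, f w) : nat).
  rewrite (sum_eq_sq (fun v => (g v, f v))) /sqsum big_sumType /= mul2n -addnn.
  have h a b : #|[set v in touched | (g v == a) && (f v == b)]| =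
      #|[set v in touched | (g v, f v) == (a, b)]|.
    by apply: eq_card => v; rewrite !inE.
  have e : \sum_c #|[set v in touched | (g v, f v) == c]| ^ 2 =
     \sum_a \sum_b #|[set v in touched | (g v == a) && (f v == b)]| ^ 2.
    rewrite pair_bigA /=; apply: eq_bigr => -[a b] _; by rewrite h.
  rewrite e; congr (_ + _).
    apply: eq_bigr => a _; rewrite big_sumType /= big1 ?add0n //.
  rewrite [RHS]exchange_big /=; apply: eq_bigr => b _.
  by rewrite big_sumType /= [X in _ + X]big1 ?addn0.
have degE : \sum_l deg table l ^ 2 =
    \sum_(v in touched) \sum_(w in touched) (g v == g w : nat) +
    \sum_(v in touched) \sum_(w in touched) (f v == f w : nat).
  rewrite big_sumType /= !sum_eq_sq; congr (_ + _); apply: eq_bigr => c _.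
    by rewrite deg_table_inl.
  by rewrite deg_table_inr.
rewrite degE sqE -big_split /= big_distrr /= /disagree.
apply: (@leq_trans (\sum_(v in touched) \sum_w ((g v == g w) != (f v == f w) : nat)
  + \sum_(v in touched) 2 * \sum_(w in touched) ((g v, f v) == (g w, f w)))).
  rewrite -big_split /=; apply: leq_sum => v _; rewrite big_distrr /= -big_split /=.
  apply: (@leq_trans (\sum_(w in touched) ((g v == g w) != (f v == f w) : nat)
     + \sum_(w in touched) 2 * ((g v, f v) == (g w, f w)))).
    rewrite -big_split /=; apply: leq_sum => w _; rewrite xpair_eqE.
    by case: (g v == g w); case: (f v == f w).
  rewrite leq_add2r [X in _ <= X](bigID (mem touched)) /=; exact: leq_addr.
by rewrite leq_add2r [X in _ <= X](bigID (mem touched)) /= leq_addr.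
Qed.

Lemma table_demand t : \sum_(l | is_inl l && (deg table l == t)) deg table l =
  #|[set v in touched | #|fiber g v| == t]|.
Proof.
rewrite big_mkcond big_sumType /= [X in _ + X]big1 // addn0 -big_mkcond /=.
rewrite -sum1dep_card (partition_big g (fun a => deg table (inl a) == t)) /=.
  apply: eq_bigr => a /eqP dt; rewrite deg_table_inl -sum1dep_card.
  apply: eq_bigl => v; case: (boolP (v \in touched)) => //= vt.
  have [ga|] := eqVneq (g v) a; rewrite ?andbF //.
  by rewrite -deg_table_g // ga dt eqxx.
by move=> v /andP[vt /eqP <-]; rewrite deg_table_g.
Qed.

(* The optimal table has acyclic support, so a depth-first traversal of it is an
   accepted word. *)
Lemma accepted_word lo hi N0 : N0 =1 unused g -> (forall v, lo <= #|fiber f v| <= hi) ->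
  exists w : seq nat, [/\ size w <= 6 * disagree, all (fun t => t < 4) w &
    forall k, disagree <= 2 * k ->
    maccept #|V| lo hi k
      (foldl (mstep #|V| lo hi) (Some ([:: (0, 0)], N0, 0)) w)].
Proof.
move=> hN0 hf; have [y [yb yd ys yac]] := acyclic_reduction table_bipartite.
have [F [uF lF nF aF [rF cF]]] := acyclic_forest yb yac.
have degle l : deg y l <= #|V|.
  by rewrite yd; case: l => c; rewrite ?deg_table_inl ?deg_table_inr max_card.
have sumF (P : pred (A + B)) (h : A + B -> nat) : (forall l, deg y l = 0 -> h l = 0) ->
    \sum_(l <- labels F | P l) h l = \sum_(l | P l) h l.
  move=> h0; rewrite big_mkcond big_uniq //= [RHS]big_mkcond /=.
  rewrite [RHS](bigID (mem (labels F))) /= [X in _ = _ + X]big1 ?addn0 // => l.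
  by rewrite lF inE -eqn0Ngt => /eqP /h0 ->; case: ifP.
have dem t : demand is_inl (deg y) F t = #|[set v in touched | #|fiber g v| == t]|.
  rewrite /demand sumF // -table_demand.
  by apply: eq_big => [l|l _]; rewrite !yd.
have sub t : #|[set v in touched | #|fiber g v| == t]| <= unused g t.
  by apply: subset_leq_card; apply/subsetP=> v; rewrite !inE => /andP[].
have [|||||N [run hN]] := @run_word _ is_inl (deg y) #|V| lo hi F 0 0 [::] N0 0.
- exact: aF.
- exact: nF.
- move=> [a|b] //; rewrite lF inE yd deg_table_inr => /card_gt0P[v].
  by rewrite inE => /andP[vt /eqP <-] _; rewrite -deg_table_inr deg_table_f.
- by move=> l _; apply: degle.
- by move=> t; rewrite dem hN0.
exists (word F); split; last 1 first.
- move=> k dk; rewrite run rF addn0 /maccept; apply/andP; split.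
    (* Passing from the table to [y] only raises [sqsum], so by [cF] twice the cost is at most
       [disagree]. *)
    have := deg_table_sq.
    have -> : \sum_l deg table l ^ 2 = \sum_l deg y l ^ 2.
      by apply: eq_bigr => l _; rewrite yd.
    by move: cF ys dk; clear; lia.
  (* If vertices remain in components of size [t], one of them is untouched. Its component is then
     also a cluster of [f], so [t] is admissible. *)
  apply/allP=> t _; case: eqP => //= /eqP; rewrite -lt0n hN dem hN0 subn_gt0 => h.
  have /subsetPn[v vt] : ~~ ([set v | #|fiber g v| == t] \subset
      [set v in touched | #|fiber g v| == t]).
    by apply: contraTN h => /subset_leq_card; rewrite -leqNgt.
  move: vt; rewrite !inE => /eqP ev; rewrite ev eqxx andbT negbK => /eqP e.
  by rewrite -ev e.
- apply: leq_trans (size_word nF) _.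
  (* Nodes have positive degree, so [S l + 2 <= 3 * S l]. *)
  apply: (@leq_trans (\sum_(l <- labels F) 3 * deg y l)).
    rewrite big_seq_cond [X in _ <= X]big_seq_cond; apply: leq_sum => l.
    by rewrite andbT lF inE; lia.
  rewrite -big_distrr /= sumF // (eq_bigr _ (fun l _ => yd l)) sum_deg_table.
  by have := card_touched; lia.
- exact: all_word.
Qed.

End Table.

(** * From an accepted word to an editing *)

Section Units.
Implicit Types (u v : nat * nat) (us : seq (nat * nat)) (l : nat).

Definition inc l u : bool := (u.1 == l) || (u.2 == l).

(** Two moved vertices form an edited pair exactly when they share either the old component or the
    new cluster, but not both. *)
Definition udist u us : nat :=
  \sum_(v <- us) ((u.1 == v.1) != (u.2 == v.2) : nat).

Definition usum us : nat := \sum_(u <- us) udist u us.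

Definition typed u : bool := odd u.1 && ~~ odd u.2.

Lemma usum_cons u us : usum (u :: us) = usum us + 2 * udist u us.
Proof.
rewrite /usum big_cons {1}/udist big_cons !eqxx /= add0n -/(udist u us).
have -> : \sum_(v <- us) udist v (u :: us) = udist u us + usum us.
  rewrite /usum /udist -big_split /=; apply: eq_bigr => v _.
  by rewrite big_cons [v.1 == _]eq_sym [v.2 == _]eq_sym.
by rewrite /usum; lia.
Qed.

Lemma inc_odd l u : typed u -> odd l -> inc l u = (u.1 == l).
Proof.
move=> /andP[_ u2] ol; rewrite /inc; case: (u.2 =P l) => [e|]; rewrite ?orbF //.
by move: u2; rewrite e ol.
Qed.

Lemma inc_even l u : typed u -> ~~ odd l -> inc l u = (u.2 == l).
Proof.
move=> /andP[u1 _] ol; rewrite /inc; case: (u.1 =P l) => [e|] //.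
by move: ol; rewrite -e u1.
Qed.

(** Justifies the cost [s + s' - 2 * x] of token 3: pairs meeting in exactly one coordinate, by
    inclusion and exclusion. *)
Lemma udist_count u us : typed u -> all typed us ->
  udist u us = count (inc u.1) us + count (inc u.2) us
    - 2 * count (predI (inc u.1) (inc u.2)) us.
Proof.
move=> /andP[u1 u2] tus.
suff : udist u us + 2 * count (predI (inc u.1) (inc u.2)) us =
    count (inc u.1) us + count (inc u.2) us by lia.
elim: us tus => [|v us IH] /=; first by rewrite /udist big_nil.
case/andP=> tv /IH {}IH; rewrite /udist big_cons -/(udist u us).
rewrite !(inc_odd tv u1) !(inc_even tv u2) [v.1 == _]eq_sym [v.2 == _]eq_sym.
by move: IH; case: (_ == v.1); case: (_ == v.2); rewrite /=; lia.
Qed.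

Fixpoint stack_labels us (stk : seq (nat * nat)) (lab : seq nat) : Prop :=
  match stk, lab with
  | [::], [::] => True
  | (s, x) :: stk', l :: lab' =>
      [/\ s = count (inc l) us,
          (if lab' is l' :: _ then x = count (predI (inc l) (inc l')) us else True),
          odd l = odd (size lab') & stack_labels us stk' lab']
  | _, _ => False
  end.

Lemma stack_labels_size us stk lab : stack_labels us stk lab ->
  size stk = size lab.
Proof. by elim: stk lab => [|[s x] stk IH] [|l lab] //= [_ _ _ /IH ->]. Qed.

Lemma stack_labels_cons u us stk lab : {in lab, forall l, ~~ inc l u} ->
  stack_labels us stk lab -> stack_labels (u :: us) stk lab.
Proof.
elim: stk lab => [|[s x] stk IH] [|l lab] //= h [sE xE ol h1].
have hl : inc l u = false by apply/negbTE/h; rewrite mem_head.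
split=> //; rewrite ?hl //; last by apply: IH h1 => l' l'lab; apply: h;
  rewrite inE l'lab orbT.
Qed.

End Units.

Section Soundness.
Variables (V : finType) (G : eqType) (g : V -> G) (n lo hi : nat).
Implicit Types (asg : V -> option (nat * nat)) (us : seq (nat * nat)) (lab : seq nat).

(* [us] lists the vertices moved so far as (old component, new cluster) pairs,
   with odd labels for components and even labels for clusters; [lab] labels the
   open nodes; [asg] realises the pairs of the closed components by vertices. *)
Record realised (stk : seq (nat * nat)) (N : nat -> nat) (c : nat)
    us lab asg (nxt : nat) : Prop := Realised {
  rz_stk : stack_labels us stk lab;
  rz_uniq : uniq lab;
  rz_lab : all (fun l => l < nxt) lab;
  rz_typed : all typed us;
  rz_fresh : all (fun u => (u.1 < nxt) && (u.2 < nxt)) us;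
  rz_perm : perm_eq (pmap asg (enum V)) [seq u <- us | u.1 \notin lab];
  rz_same : forall v w u u', asg v = Some u -> asg w = Some u' ->
    (g v == g w) = (u.1 == u'.1);
  rz_full : forall v w, asg v != None -> g v = g w -> asg w != None;
  rz_N : forall s, N s = #|[set v | (asg v == None) && (#|fiber g v| == s)]|;
  rz_col : {in us, forall u, u.2 \notin lab -> lo <= count (inc u.2) us <= hi};
  rz_cost : 2 * c = usum us }.

Definition sound (st : option config) : Prop :=
  if st is Some (stk, N, c) then exists us lab asg nxt,
    realised stk N c us lab asg nxt else True.

Lemma sound_init N : N =1 unused g -> sound (Some ([:: (0, 0)], N, 0)).
Proof.
move=> hN; exists [::], [:: 0], (fun=> None), 1; split=> //=.
- by rewrite (_ : pmap _ _ = [::]) //; elim: (enum V).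
- by rewrite /usum big_nil.
Qed.

(** Doubling [nxt] gives room for a fresh label of either parity; the parity is dictated by the
    height of the node. *)
Lemma sound_open stk N c us lab asg nxt :
  realised stk N c us lab asg nxt ->
  realised ((0, 0) :: stk) N c us (nxt.*2 + odd (size lab) :: lab) asg nxt.*2.+2.
Proof.
case=> h1 h2 /allP h3 h4 /allP h5 h6 h7 h8 h9 h10 h11.
set l := nxt.*2 + odd (size lab); have nl : nxt <= l by rewrite /l; lia.
have uf u : u \in us -> (u.1 == l) = false /\ (u.2 == l) = false.
  by move=> /h5 /andP[a b]; split; apply: ltn_eqF; apply: leq_trans nl.
have i0 : count (inc l) us = 0.
  by apply/eqP; rewrite -leqn0 leqNgt -has_count; apply/hasPn=> u /uf[e1 e2];
     rewrite /inc e1 e2.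
split=> //.
- split=> //; last 1 first.
  + by rewrite /l oddD odd_double oddb.
  + case: (lab) => // l' _; apply/esym/eqP; rewrite -leqn0 -i0.
    by apply: sub_count => u /andP[].
- rewrite /= h2 andbT; apply/negP=> /h3; lia.
- apply/allP=> l'; rewrite inE => /orP[/eqP ->|/h3]; first by rewrite /l; lia.
  by clear; lia.
- by apply/allP=> u /h5 /andP[]; clear; lia.
- rewrite (perm_trans h6) //; apply/permP => p; congr (count _ _).
  by apply: eq_in_filter => u /uf[e _]; rewrite inE e.
- by move=> u us_; rewrite inE negb_or => /andP[_]; apply: h10.
Qed.

Lemma sound_unit s x s' x' stk N c us lab asg nxt :
  realised ((s, x) :: (s', x') :: stk) N c us lab asg nxt ->
  exists us', realised ((s.+1, x.+1) :: (s'.+1, x') :: stk) N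
    (c + (s + s' - 2 * x)) us' lab asg nxt.
Proof.
case=> h1 h2 h3 h4 h5 h6 h7 h8 h9 h10 h11.
case: lab h1 h2 h3 h6 h10 => [|l [|l' lab]] h1 h2 h3 h6 h10; [by []|by case: h1|].
case: h1 => sE xE ol [sE' xE' ol' h1].
have oll : odd l = ~~ odd l' by rewrite ol ol'.
(* Which of the two top nodes is the component depends on parity; pairs always list the component
   first. *)
pose u0 := if odd l then (l, l') else (l', l).
have [i1 i2] : inc l u0 /\ inc l' u0.
  by rewrite /u0 /inc; case: (odd l); rewrite /= !eqxx !orbT.
have inc0 m : inc m u0 = (m == l) || (m == l').
  by rewrite /u0 /inc; case: (odd l); rewrite /= ![_ == m]eq_sym // orbC.
have tu0 : typed u0.
  by rewrite /u0 /typed; case E: (odd l) oll => /= /esym; rewrite ?E; case: (odd l').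
have u01 : u0.1 \in [:: l, l' & lab].
  by rewrite /u0; case: (odd l); rewrite !inE eqxx ?orbT.
have u02 : u0.2 \in [:: l, l' & lab].
  by rewrite /u0; case: (odd l); rewrite !inE eqxx ?orbT.
move: (h2) => /= /andP[+ /andP[l'lab _]]; rewrite inE negb_or => /andP[ll' llab].
have h0 : {in lab, forall m, ~~ inc m u0}.
  move=> m mlab; rewrite inc0 negb_or; apply/andP; split.
    by apply: contraNneq llab => <-.
  by apply: contraNneq l'lab => <-.
have cost : udist u0 us = s + s' - 2 * x.
  rewrite udist_count // sE sE' xE /u0; case: (odd l) => //=.
  rewrite addnC; congr (_ - 2 * _); apply: eq_count => u /=; exact: andbC.
exists (u0 :: us); split=> //.
- split=> //=; first by rewrite i1 sE.
    by rewrite i1 i2 xE.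
  split=> //=; first by rewrite i2 sE'.
    case: lab xE' h0 {h1 h2 h3 h6 h10 ol ol' u01 u02 llab l'lab} => // l'' lab -> h0.
    by rewrite (negbTE (h0 l'' _)) ?mem_head // andbF.
  exact: stack_labels_cons.
- by rewrite /= tu0.
- move: h3 => /= /and3P[lx l'x _]; rewrite h5 andbT.
  by rewrite /u0; case: (odd l); rewrite /= lx l'x.
- by rewrite /= u01.
- move=> u; rewrite inE => /orP[/eqP ->|uus]; first by rewrite u02.
  move=> ulab; have := h10 u uus ulab; rewrite /= inc0.
  have [-> ->] : (u.2 == l) = false /\ (u.2 == l') = false.
    by move: ulab; rewrite !inE !negb_or => /and3P[/negbTE -> /negbTE ->].
  by [].
- by rewrite usum_cons cost -h11 mulnDr.
Qed.

Lemma sound_close_col s x stk N c us lab asg nxt : ~~ odd (size stk) ->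
  lo <= s <= hi -> realised ((s, x) :: stk) N c us lab asg nxt ->
  exists lab', realised stk N c us lab' asg nxt.
Proof.
move=> ev hs [h1 h2 h3 h4 h5 h6 h7 h8 h9 h10 h11].
case: lab h1 h2 h3 h6 h10 => [|l lab] h1 h2 h3 h6 h10; first by [].
case: h1 => sE _ ol h1; have el : ~~ odd l.
  by rewrite ol -(stack_labels_size h1).
exists lab; split=> //.
- by move: h2 => /andP[].
- by move: h3 => /andP[].
- rewrite (perm_trans h6) //; apply/permP => p; congr (count _ _).
  apply: eq_in_filter => u /(allP h4) /andP[o1 _]; rewrite inE.
  by case: eqP => // e; move: el; rewrite -e o1.
- move=> u uus ulab; have [->|n2] := eqVneq u.2 l; first by rewrite -sE.
  by apply: h10; rewrite // inE negb_or n2.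
Qed.

Lemma sound_close_row s x stk N c us lab asg nxt : odd (size stk) ->
  s <= N s -> realised ((s, x) :: stk) N c us lab asg nxt ->
  exists lab' asg', realised stk (upd N s (N s - s)) c us lab' asg' nxt.
Proof.
move=> ev hs [h1 h2 h3 h4 h5 h6 h7 h8 h9 h10 h11].
case: lab h1 h2 h3 h6 h10 => [|l lab] h1 h2 h3 h6 h10; first by [].
case: h1 => sE _ ol h1; have {}ol : odd l.
  by rewrite ol -(stack_labels_size h1).
move: (h2) => /= /andP[llab ulab].
pose cs := [seq u <- us | u.1 == l].
have size_cs : size cs = s.
  rewrite size_filter sE; apply: eq_in_count => u /(allP h4) tu.
  by rewrite inc_odd.
have col' : {in us, forall u, u.2 \notin lab -> lo <= count (inc u.2) us <= hi}.
  move=> u uus ul; apply: h10; rewrite // inE negb_or ul andbT.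
  by apply: contraTneq ol => <-; case/andP: (allP h4 _ uus).
have permcs : perm_eq [seq u <- us | u.1 \notin lab]
    (cs ++ [seq u <- us | u.1 \notin l :: lab]).
  rewrite -(perm_filterC (fun u => u.1 == l) [seq u <- us | _]) -!filter_predI.
  apply/permP=> p; rewrite !count_cat; congr (_ + _); congr (count _ _).
    by apply: eq_filter => u /=; case: eqP => // ->.
  by apply: eq_filter => u /=; rewrite inE negb_or.
have lab'x : all (fun l0 => l0 < nxt) lab by move: h3 => /andP[].
have [s0|sp] := posnP s.
  exists lab, asg; split=> //.
  - rewrite (perm_trans h6) // perm_sym (perm_trans permcs) //.
    by move/eqP: size_cs; rewrite s0 size_eq0 => /eqP ->.
  - move=> t; rewrite /upd s0 subn0; case: eqP => [->|_]; exact: h9.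
(* Assignments cover whole components ([h8]), so the entire fiber of one unassigned vertex is
   free. *)
have [v0] : exists v, (asg v == None) && (#|fiber g v| == s).
  have : 0 < N s by apply: leq_trans hs.
  by rewrite h9 => /card_gt0P[v]; rewrite inE; exists v.
case/andP=> /eqP v0N /eqP v0s; pose H := fiber g v0.
have HN v : v \in H -> asg v = None.
  rewrite inE => /eqP gv; apply/eqP; apply/negPn/negP=> /h8/(_ gv).
  by rewrite v0N.
have Hs v : v \in H -> #|fiber g v| = s.
  by rewrite inE => /eqP gv; rewrite -v0s; apply: eq_card => w; rewrite !inE gv.
pose asg' v := if v \in H then Some (nth (0, 0) cs (index v (enum H))) else asg v.
have mapH : pmap asg' (enum H) = cs.
  transitivity (pmap (some \o (fun v => nth (0, 0) cs (index v (enum H)))) (enum H)).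
    by apply: eq_in_pmap => v; rewrite mem_enum /asg' => ->.
  have -> : forall t : seq V,
      pmap (some \o (fun v => nth (0, 0) cs (index v (enum H)))) t
      = map (fun v => nth (0, 0) cs (index v (enum H))) t.
    by elim=> //= v t ->.
  apply: (@eq_from_nth _ (0, 0)); first by rewrite size_map -cardE v0s size_cs.
  move=> i; rewrite size_map => iH; rewrite (nth_map v0) // index_uniq //.
  exact: enum_uniq.
have asgcs v u : v \in H -> asg' v = Some u -> u \in cs.
  by move=> vH e; rewrite -mapH mem_pmap; apply/mapP; exists v; rewrite ?mem_enum.
have asgl v u : asg v = Some u -> u.1 != l.
  move=> e; have : u \in pmap asg (enum V).
    by rewrite mem_pmap; apply/mapP; exists v; rewrite ?mem_enum.
  rewrite (perm_mem h6) mem_filter inE negb_or => /andP[/andP[]]; done.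
have same1 v w u u' : v \in H -> w \notin H -> asg' v = Some u -> asg' w = Some u' ->
    (g v == g w) = (u.1 == u'.1).
  move=> vH wH /(asgcs _ _ vH); rewrite mem_filter => /andP[/eqP -> _].
  rewrite /asg' (negbTE wH) => /asgl; rewrite eq_sym => /negbTE ->.
  move: vH wH; rewrite !inE => /eqP -> /negbTE; rewrite eq_sym; done.
exists lab, asg'; split=> //.
- have pH : perm_eq (enum V) (enum H ++ [seq v <- enum V | v \notin H]).
    apply: uniq_perm; first exact: enum_uniq.
      rewrite cat_uniq enum_uniq filter_uniq ?enum_uniq // andbT.
      by apply/hasPn=> v; rewrite mem_filter mem_enum => /andP[].
    move=> v; rewrite mem_enum mem_cat [X in _ || X]mem_filter !mem_enum.
    by case: (v \in H).
  have pE (f : V -> option (nat * nat)) : perm_eq (pmap f (enum V))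
      (pmap f (enum H) ++ pmap f [seq v <- enum V | v \notin H]).
    by rewrite -pmap_cat (perm_pmap _ pH).
  rewrite (permPl (pE asg')) mapH (permPr permcs) perm_cat2l.
  rewrite -(permPr h6) (permPr (pE asg)).
  have -> : pmap asg (enum H) = [::].
    have : {in enum H, asg =1 fun=> None} by move=> v; rewrite mem_enum; apply: HN.
    by move/eq_in_pmap ->; elim: (enum H).
  apply/permP=> p; congr (count _ _); apply: eq_in_pmap => v.
  by rewrite mem_filter /asg' => /andP[/negbTE ->].
- move=> v w u u'; case: (boolP (v \in H)) => vH; case: (boolP (w \in H)) => wH.
  + move=> /(asgcs _ _ vH); rewrite mem_filter => /andP[/eqP -> _].
    move=> /(asgcs _ _ wH); rewrite mem_filter => /andP[/eqP -> _].
    by move: vH wH; rewrite !inE => /eqP -> /eqP ->; rewrite !eqxx.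
  + exact: same1.
  + by move=> e e'; rewrite eq_sym [RHS]eq_sym; apply: (same1 w v).
  + by rewrite /asg' (negbTE vH) (negbTE wH); apply: h7.
- move=> v w; rewrite /asg' => + gvw; have -> : (w \in H) = (v \in H).
    by rewrite !inE gvw.
  by case: (v \in H) => // /h8; apply.
- move=> t; rewrite /upd; case: eqP => [->|/eqP ts].
    have -> : [set v | (asg' v == None) && (#|fiber g v| == s)] =
        [set v | (asg v == None) && (#|fiber g v| == s)] :\: H.
      by apply/setP=> v; rewrite in_setD 2!in_set /asg'; case: (v \in H).
    rewrite cardsD -h9 -[in X in _ - X]v0s; congr (_ - _); apply: eq_card => v.
    rewrite in_setI in_set; case: (boolP (v \in H)) => vH; rewrite ?andbF //.
    by rewrite (HN _ vH) (Hs _ vH) !eqxx.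
  rewrite h9; apply: eq_card => v; rewrite 2!in_set /asg'.
  case: (boolP (v \in H)) => // vH; rewrite (Hs _ vH) [s == t]eq_sym (negbTE ts).
  by rewrite andbF.
Qed.

Lemma sound_step st t : sound st -> sound (mstep n lo hi st t).
Proof.
case: st => [[[stk N] c]|] // [us [lab [asg [nxt h]]]].
case: t => [|[|[|[|t]]]]; try by exists us, lab, asg, nxt.
- by do 4!eexists; exact: (sound_open h).
- case: stk h => [|[s x] [|y stk]] h //; rewrite /mstep.
  case: ifP => od; case: ifP => // hs.
    case/andP: hs => _ hs; have [lab' [asg' h']] := sound_close_row od hs h.
    by exists us, lab', asg', nxt.
  have [lab' h'] := sound_close_col (negbT od) hs h.
  by exists us, lab', asg, nxt.
- case: stk h => [|[s x] [|[s' x'] stk]] h //.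
  have [us' h'] := sound_unit h.
  by exists us', lab, asg, nxt.
Qed.

Lemma sound_accept k st : sound st -> maccept n lo hi k st -> #|V| <= n ->
  exists f : V -> (nat + G)%type,
    \sum_v \sum_w ((g v == g w) != (f v == f w) : nat) <= 2 * k /\
    forall v, lo <= #|fiber f v| <= hi.
Proof.
case: st => [[[[|[[|s] x] [|y stk]] N] c]|] // [us [lab [asg [nxt h]]]].
rewrite /maccept.
case: h => h1 h2 h3 h4 h5 h6 h7 h8 h9 h10 h11 /andP[ck okN] Vn.
case: lab h1 h2 h3 h6 h10 => [|l [|l' lab]] h1 h2 h3 h6 h10 //; last by case: h1.
case: h1 => s0 _ _ _.
have noinc u : u \in us -> (u.1 != l) && (u.2 != l).
  move=> uus; rewrite -negb_or; apply/negP=> iu.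
  have : has (inc l) us by apply/hasP; exists u.
  by rewrite has_count -s0.
have pus : perm_eq (pmap asg (enum V)) us.
  rewrite (perm_trans h6) //; apply/permP => p; congr (count _ _).
  by apply/all_filterP/allP=> u /noinc /andP[]; rewrite inE.
(* Moved vertices take the name of their new cluster, the others keep their component; the disjoint
   sum prevents clashes of names. *)
pose f v : (nat + G)%type := if asg v is Some u then inl u.2 else inr (g v).
have sumus (F : nat * nat -> nat) :
    \sum_v (if asg v is Some u then F u else 0) = \sum_(u <- us) F u.
  rewrite -(perm_big _ pus) /= -big_enum /=.
  by elim: (enum V) => [|v t IH]; rewrite ?big_nil // big_cons IH /=;
    case: (asg v) => [u|] //=; rewrite big_cons.
have gN v w u : asg v = Some u -> asg w = None -> (g v == g w) = false.
  by move=> ev ew; apply/eqP=> /(h8 v w); rewrite ev ew => /(_ isT).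
exists f; split.
  apply: (@leq_trans (2 * c)); last by rewrite leq_mul2l.
  rewrite h11 /usum -sumus; apply: leq_sum => v _; rewrite /f.
  case ev: (asg v) => [u|]; last first.
    rewrite big1 // => w _; case ew: (asg w) => [u'|]; last by rewrite eqxx.
    by rewrite [g v == _]eq_sym (gN w v u').
  rewrite /udist -sumus; apply: leq_sum => w _.
  case ew: (asg w) => [u'|]; first by rewrite (h7 _ _ _ _ ev ew).
  by rewrite (gN v w u).
move=> v; case ev: (asg v) => [u|].
  have uus : u \in us.
    rewrite -(perm_mem pus) mem_pmap; apply/mapP.
    by exists v; rewrite ?mem_enum.
  have -> : #|fiber f v| = count (inc u.2) us.
    rewrite -sum1_count -sum1_card big_mkcond [RHS]big_mkcond /=.
    rewrite -(sumus (fun u' => if inc u.2 u' then 1 else 0)).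
    apply: eq_bigr => w _; rewrite inE /f ev; case ew: (asg w) => [u'|] //.
    have u'us : u' \in us.
      by rewrite -(perm_mem pus) mem_pmap; apply/mapP; exists w; rewrite ?mem_enum.
    by rewrite (inc_even (allP h4 _ u'us)) //; case/andP: (allP h4 _ uus).
  by apply: h10; rewrite // inE; case/andP: (noinc _ uus).
have -> : #|fiber f v| = #|fiber g v|.
  apply: eq_card => w; rewrite !inE /f ev; case ew: (asg w) => [u|] //.
  by rewrite (gN w v u).
have Np : 0 < N #|fiber g v|.
  by rewrite h9; apply/card_gt0P; exists v; rewrite inE ev !eqxx.
have := allP okN #|fiber g v|; rewrite mem_iota ltnS (leq_trans (max_card _) Vn).
by rewrite gtn_eqF //; apply.
Qed.

Lemma sound_run k N w : #|V| <= n -> N =1 unused g ->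
  maccept n lo hi k (foldl (mstep n lo hi) (Some ([:: (0, 0)], N, 0)) w) ->
  exists f : V -> (nat + G)%type,
    \sum_v \sum_w ((g v == g w) != (f v == f w) : nat) <= 2 * k /\
    forall v, lo <= #|fiber f v| <= hi.
Proof.
move=> Vn hN acc; apply: sound_accept acc Vn.
have := sound_init hN; elim: w (Some _) => //= t w IH st h.
by apply: IH; apply: sound_step.
Qed.

End Soundness.

(** * Branching on induced paths *)

Section Branching.
Variable n : nat.
Notation V := 'I_n.
Notation graph := {set {set V}}.

(* Current graph, unread part of the certificate, number of edits made. *)
Definition bstate : Type := (graph * nat * nat)%type.
Implicit Types (E : graph) (st : bstate) (i j l : V).

(** The condition [l < i] picks one orientation of each induced path and makes its ends distinct. *)
Definition p3 E i l j : bool := [&& l < i, adj E i j, adj E j l & ~~ adj E i l].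

Definition bstep st i l j : bstate :=
  let: (E, z, u) := st in
  if p3 E i l j then
    (match z %% 4 with
     | 0 => E :\ [set i; j]
     | 1 => E :\ [set j; l]
     | _ => [set i; l] |: E
     end, z %/ 4, u.+1)
  else st.

Definition bround st : bstate :=
  foldl (fun st i => foldl (fun st l => foldl (fun st j => bstep st i l j)
    st (enum V)) st (enum V)) st (enum V).

Lemma foldl_inv (S A : Type) (P : S -> Prop) (f : S -> A -> S) (s : S) xs :
  (forall s x, P s -> P (f s x)) -> P s -> P (foldl f s xs).
Proof. by move=> h; elim: xs s => //= x xs IH s Ps; apply/IH/h. Qed.

Lemma bround_dist E0 st : E0 \subset pairs V ->
  (st.1.1 \subset pairs V) /\ #|symdiff E0 st.1.1| <= st.2 ->
  ((bround st).1.1 \subset pairs V) /\ #|symdiff E0 (bround st).1.1| <= (bround st).2.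
Proof.
move=> E0p h0; pose P st := (st.1.1 \subset pairs V) /\ #|symdiff E0 st.1.1| <= st.2.
apply: (foldl_inv (P := P)) h0 => {}st i h0.
apply: (foldl_inv (P := P)) h0 => {}st l h0.
apply: (foldl_inv (P := P)) h0 => {}st j.
case: st => [[E z] u]; rewrite /P /= => -[Ep d]; case: ifP => [/and4P[li ij jl il]|] //.
have e1 e e' : e' != e -> (e' \in E :\ e) = (e' \in E).
  by rewrite in_setD1 => ->.
have e2 e e' : e' != e -> (e' \in e |: E) = (e' \in E).
  by rewrite in_setU1 => /negbTE ->.
case: (z %% 4) => [|[|m]]; split=> /=.
- by apply: subset_trans Ep; apply: subsetDl.
- by apply: leq_trans (symdiff_flip_le _ (e1 _)) _.
- by apply: subset_trans Ep; apply: subsetDl.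
- by apply: leq_trans (symdiff_flip_le _ (e1 _)) _.
- by rewrite subUset Ep andbT sub1set pair2 eq_sym -(inj_eq val_inj) (ltn_eqF li).
- by apply: leq_trans (symdiff_flip_le _ (e2 _)) _.
Qed.

(** A sweep tests its triples on a changing graph. If the edit counter stands still, all of them
    were tested on the same graph, so the tests together describe that graph. *)
Definition quiet (F : bstate -> bstate) (C : graph -> Prop) : Prop :=
  forall st, st.2 <= (F st).2 /\ ((F st).2 = st.2 -> F st = st /\ C st.1.1).

Lemma quiet_foldl (A : eqType) (f : bstate -> A -> bstate) C xs :
  (forall x, quiet (f^~ x) (C x)) ->
  quiet (fun st => foldl f st xs) (fun E => forall x, x \in xs -> C x E).
Proof.
move=> h; elim: xs => [|x xs IH] st //=.
have [h1 h2] := h x st; have [h3 h4] := IH (f st x); split.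
  exact: leq_trans h3.
move=> e; have [|e1 c1] := h2; first by lia.
have [|e2 c2] := h4; first by rewrite e e1.
split; first by rewrite e2.
move=> y; rewrite inE => /orP[/eqP -> //|yxs]; rewrite e1 in c2; exact: c2.
Qed.

Lemma quiet_bround : quiet bround (fun E => forall i l j, ~~ p3 E i l j).
Proof.
have q i l j : quiet (fun st => bstep st i l j) (fun E => ~~ p3 E i l j).
  move=> [[E z] u]; rewrite /bstep; case: ifP => /= [_|/negbT c]; last by [].
  by split=> // /esym /n_Sn.
have q1 i l := @quiet_foldl _ (fun st j => bstep st i l j) _ (enum V) (q i l).
have q2 i := @quiet_foldl _ (fun st l => foldl (fun st j => bstep st i l j) st
  (enum V)) _ (enum V) (q1 i).
move=> st; have [h1 h2] := quiet_foldl (enum V) q2 st.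
split=> // /h2 [e c]; split=> // i l j.
by apply: c; rewrite mem_enum.
Qed.

Lemma bround_fix E z u : (forall i l j, ~~ p3 E i l j) ->
  bround (E, z, u) = (E, z, u).
Proof.
move=> h; have fx (f : bstate -> V -> bstate) :
    (forall x, f (E, z, u) x = (E, z, u)) ->
    foldl f (E, z, u) (enum V) = (E, z, u).
  by move=> hf; elim: (enum V) => //= x xs; rewrite hf.
apply: (fx) => i; apply: (fx) => l; apply: (fx) => j.
by rewrite /bstep (negbTE (h _ _ _)).
Qed.

Lemma no_p3 E : (forall i l j, ~~ p3 E i l j) -> p3free E.
Proof.
move=> h x y z + xy yz; rewrite neq_ltn => /orP[c|c].
  rewrite adjC; have := h z x y; rewrite /p3 c [adj E z y]adjC yz /=.
  by rewrite [adj E y x]adjC xy /= negbK.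
by have := h x z y; rewrite /p3 c xy yz /= negbK.
Qed.

(** A round without edits leaves no induced path for good, and [k + 1] rounds with edits make more
    than [k] of them. *)
Lemma brounds_p3free k E z : (iter k.+1 bround (E, z, 0)).2 <= k ->
  p3free (iter k.+1 bround (E, z, 0)).1.1.
Proof.
set st := (E, z, 0).
suff h m : (m <= (iter m bround st).2) \/
    (forall i l j, ~~ p3 (iter m bround st).1.1 i l j).
  by have [h1|/no_p3 //] := h k.+1; rewrite leqNgt h1.
elim: m => [|m [IH|IH]]; [by left| |]; rewrite iterS.
  have [q1 q2] := quiet_bround (iter m bround st).
  have [e|ne] := eqVneq (bround (iter m bround st)).2 (iter m bround st).2.
    by have [e' c] := q2 e; right; rewrite e'.
  by left; apply: leq_ltn_trans IH _; rewrite ltn_neqAle eq_sym ne.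
right; case: (iter m bround st) IH => [[E1 z1] u1] IH.
by rewrite bround_fix.
Qed.

(* Some prefix of the certificate makes [F] move towards [E'] with every edit;
   [zr] is the part of the certificate left unread. *)
Definition steerable E' (F : bstate -> bstate) : Prop :=
  forall E, exists E1 d, #|symdiff E1 E'| + d <= #|symdiff E E'| /\
    forall zr, exists z, z < zr.+1 * 4 ^ d /\
      forall u, F (E, z, u) = (E1, zr, u + d).

Lemma steerable_id E' : steerable E' id.
Proof.
move=> E; exists E, 0; rewrite addn0; split=> // zr; exists zr.
by rewrite muln1; split=> // u; rewrite addn0.
Qed.

Lemma steerable_comp E' F1 F2 : steerable E' F1 -> steerable E' F2 ->
  steerable E' (F2 \o F1).
Proof.
move=> h1 h2 E; have [E1 [d1 [k1 z1]]] := h1 E; have [E2 [d2 [k2 z2]]] := h2 E1.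
exists E2, (d2 + d1); split; first by lia.
move=> zr; have [y [yb ye]] := z2 zr; have [x [xb xe]] := z1 y.
exists x; split; last by move=> u; rewrite /= xe ye addnA addnAC.
apply: leq_trans xb _; rewrite expnD mulnA leq_mul2r yb orbT; done.
Qed.

Lemma steerable_foldl E' (A : Type) (f : bstate -> A -> bstate) xs :
  (forall x, steerable E' (f^~ x)) -> steerable E' (fun st => foldl f st xs).
Proof.
move=> h; elim: xs => [|x xs IH] /=; first exact: steerable_id.
exact: (steerable_comp (h x) IH).
Qed.

(** The target has no induced path, so it differs from [E] on one of the three pairs; the digit
    naming that pair brings the graph one edit closer. *)
Lemma steerable_bstep E' i l j : p3free E' ->
  steerable E' (fun st => bstep st i l j).
Proof.
move=> p3E' E; rewrite /bstep; case: (boolP (p3 E i l j)) => [c|_]; last first.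
  exact: steerable_id.
case/and4P: c => li ij jl il.
have go (dg : nat) E1 : dg < 4 -> #|symdiff E E'| = #|symdiff E1 E'|.+1 ->
    match dg with
     | 0 => E :\ [set i; j]
     | 1 => E :\ [set j; l]
     | _ => [set i; l] |: E
     end = E1 ->
   exists E1 d, #|symdiff E1 E'| + d <= #|symdiff E E'| /\
    forall zr, exists z, z < zr.+1 * 4 ^ d /\
      forall u, (match z %% 4 with
        | 0 => E :\ [set i; j]
        | 1 => E :\ [set j; l]
        | _ => [set i; l] |: E
        end, z %/ 4, u.+1) = (E1, zr, u + d).
  move=> dg4 dE eE1; exists E1, 1; rewrite dE addn1; split=> // zr.
  exists (zr * 4 + dg); split; first by rewrite expn1; lia.
  by move=> u; rewrite modnMDl divnMDl // modn_small // divn_small // addn0 addn1 eE1.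
have flipD e : e \in E -> e \notin E' -> #|symdiff E E'| = #|symdiff (E :\ e) E'|.+1.
  move=> eE eE'; apply: (symdiff_flip (e := e)).
  - by move=> e'; rewrite in_setD1 => ->.
  - by rewrite in_symdiff eE (negbTE eE').
  - by rewrite in_symdiff in_setD1 eqxx (negbTE eE').
case: (boolP (adj E' i j)) => [ij'|ij']; last exact: (go 0 _ isT (flipD _ ij ij')).
case: (boolP (adj E' j l)) => [jl'|jl']; last exact: (go 1 _ isT (flipD _ jl jl')).
apply: (go 2 ([set i; l] |: E)) => //; apply: (symdiff_flip (e := [set i; l])).
- by move=> e'; rewrite in_setU1 => /negbTE ->.
- rewrite in_symdiff -/(adj E i l) (negbTE il) /=; apply: (p3E' i j l) => //.
  by rewrite eq_sym -(inj_eq val_inj) (ltn_eqF li).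
- rewrite in_symdiff setU11 /= negbK; apply: (p3E' i j l) => //.
  by rewrite eq_sym -(inj_eq val_inj) (ltn_eqF li).
Qed.

Lemma steerable_brounds E' m : p3free E' -> steerable E' (iter m bround).
Proof.
move=> p3E'; elim: m => [|m IH]; first exact: steerable_id.
apply: (steerable_comp IH); apply: steerable_foldl => i.
apply: steerable_foldl => l; apply: steerable_foldl => j.
exact: steerable_bstep.
Qed.

End Branching.

(** * Certificates and their verification *)

Fixpoint digits (m z : nat) : seq nat :=
  if m is m'.+1 then z %% 4 :: digits m' (z %/ 4) else [::].

(** Digits come lowest first, so padding does not change the number, and the stack machine ignores
    token 0. *)
Lemma digits_word w m : all (fun t => t < 4) w -> size w <= m ->
  exists2 z, z < 4 ^ size w & digits m z = w ++ nseq (m - size w) 0.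
Proof.
elim: m w => [|m IH] [|t w] //=.
- by exists 0.
- move=> _ _; have [z + e] := IH [::] isT (leq0n m).
  rewrite expn0 ltnS leqn0 => /eqP z0; exists 0; first by [].
  by move: e; rewrite z0 subn0 /= => ->.
- case/andP=> t4 w4 sw; have [z zb e] := IH w w4 sw.
  exists (z * 4 + t); first by rewrite expnS; lia.
  by rewrite modnMDl modn_small // divnMDl // divn_small // addn0 e.
Qed.

Definition degree_count (n : nat) (E : {set {set 'I_n}}) (s : nat) : nat :=
  #|[set v | #|[set y | adj E v y]|.+1 == s]|.

Definition verify (n : nat) (E : {set {set 'I_n}}) (k eta m lo z : nat) : bool :=
  let: (E1, z1, u1) := iter k.+1 (@bround n) (E, z, 0) in
  maccept n lo (lo + eta) k (foldl (mstep n lo (lo + eta))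
    (Some ([:: (0, 0)], degree_count E1, u1)) (digits m z1)).

(** [verify] starts the machine with the branching edits already charged, whereas [accepted_word]
    and [sound_run] start from cost 0. *)
Definition add_cost (u : nat) (st : option config) : option config :=
  if st is Some (stk, N, c) then Some (stk, N, u + c) else None.

Lemma add_cost_run u n lo hi st w :
  foldl (mstep n lo hi) (add_cost u st) w = add_cost u (foldl (mstep n lo hi) st w).
Proof.
elim: w st => //= t w IH st; rewrite -IH; congr foldl.
case: st => [[[stk N] c]|] //; case: t => [|[|[|[|t]]]] //=.
  by case: stk => [|[s x] [|y stk]] //=; do 2!case: ifP => //.
by case: stk => [|[s x] [|[s' x'] stk]] //=; rewrite addnA.
Qed.

Lemma add_cost_accept u n lo hi k st :
  maccept n lo hi k (add_cost u st) = (u <= k) && maccept n lo hi (k - u) st.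
Proof.
case: st => [[[[|[[|s] x] [|y stk]] N] c]|]; rewrite /maccept /add_cost ?andbF //.
by rewrite andbA; congr andb; lia.
Qed.

Lemma degree_count_nbh n (E : {set {set 'I_n}}) : E \subset pairs 'I_n ->
  p3free E -> degree_count E =1 unused (nbh E).
Proof.
by move=> Ep p3E s; apply: eq_card => v; rewrite !inE card_fiber_nbh.
Qed.

Lemma brounds_dist n (E : {set {set 'I_n}}) m z :
  let st := iter m (@bround n) (E, z, 0) in E \subset pairs 'I_n ->
  (st.1.1 \subset pairs 'I_n) /\ #|symdiff E st.1.1| <= st.2.
Proof.
move=> st Ep; rewrite {}/st; elim: m => [|m IHm]; last first.
  by rewrite iterS; apply: bround_dist.
by rewrite /= Ep (_ : symdiff E E = set0) ?cards0 //;
  apply/setP=> e'; rewrite in_symdiff addbb inE.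
Qed.

Theorem verify_correct n (E : {set {set 'I_n}}) k eta : E \subset pairs 'I_n ->
  balanced_cluster_editing E k eta <->
  exists lo z, [/\ lo <= n, z < 2 ^ (32 * k) & verify E k eta (32 * k) lo z].
Proof.
move=> Ep; split.
  case/(bce_label_graph Ep) => f [lo [lon dk sz]].
  have p3f : p3free (label_graph f) := @label_graph_p3free _ _ f.
  have [E1 [d [dE1 st]]] := steerable_brounds k.+1 p3f E.
  have dk1 : d <= k by lia.
  have E1z z zr : iter k.+1 (@bround n) (E, z, 0) = (E1, zr, d) ->
      E1 \subset pairs 'I_n /\ p3free E1.
    move=> e; have := brounds_p3free (k := k) (E := E) (z := z); rewrite e /= => h.
    split; last exact: h.
    have := brounds_dist k.+1 z Ep.
    by rewrite e => -[].
  have [z0 [_ e0]] := st 0; have [E1p p31] := E1z _ _ (e0 0).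
  pose g := nbh E1.
  have lg : label_graph g = E1 := label_graph_nbh E1p p31.
  have hN := degree_count_nbh E1p p31.
  have [w [sw w4 acc]] := accepted_word hN sz.
  (* Every branching edit came off the distance to the target; the factor 2 is for ordered pairs. *)
  have dis : disagree g f <= 2 * (k - d).
    rewrite /disagree sum_label_dist lg leq_mul2l /= leq_subRL // addnC.
    exact: leq_trans dE1 dk.
  have swk : size w <= 12 * k.
    apply: leq_trans sw _; apply: (@leq_trans (6 * (2 * (k - d)))); last by lia.
    by rewrite leq_mul2l.
  have swm : size w <= 32 * k by lia.
  have [zr zrb zre] := digits_word w4 swm.
  have [z [zb ze]] := st zr; exists lo, z; split.
  - by rewrite -[n]card_ord.
  (* [12k] token digits and at most [k] branching digits. *)
  - apply: (@leq_trans (4 ^ (12 * k) * 4 ^ k)).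
      apply: leq_trans zb _; apply: leq_mul; last by rewrite leq_exp2l.
      by apply: leq_trans zrb _; rewrite leq_exp2l.
    by rewrite -expnD (_ : 4 = 2 ^ 2) // -expnM leq_exp2l //; lia.
  - rewrite /verify ze add0n zre foldl_cat.
    have noop st' m : foldl (mstep n lo (lo + eta)) st' (nseq m 0) = st'.
      by elim: m => //= m IHm; case: st' IHm => [[[stk N] c]|].
    rewrite noop -[d]addn0 -/(add_cost d (Some ([:: (0,0)], degree_count E1, 0))).
    rewrite add_cost_run add_cost_accept dk1 /=.
    by have := acc (k - d) dis; rewrite card_ord.
case=> lo [z [lon zb]]; rewrite /verify.
have := brounds_p3free (k := k) (E := E) (z := z).
have := brounds_dist k.+1 z Ep.
case: (iter k.+1 _ _) => [[E1 z1] u1] /= [E1p dE1] p31.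
rewrite -[u1]addn0 -/(add_cost u1 (Some ([:: (0, 0)], degree_count E1, 0))).
rewrite add_cost_run add_cost_accept => /andP[uk acc].
have {}p31 := p31 uk; have hN := degree_count_nbh E1p p31.
have cn : #|'I_n| <= n by rewrite card_ord.
have [f [df sz]] := sound_run cn hN acc.
apply: (@label_graph_bce _ _ E f k eta lo) => //.
(* The [u1] branching edits and the at most [k - u1] edits of the word compose. *)
apply: leq_trans (symdiff_triangle _ E1 _) _.
move: df; rewrite sum_label_dist label_graph_nbh // leq_mul2l /= => df.
by apply: leq_trans (leq_add dE1 df) _; rewrite subnKC.
Qed.

(** * The program *)

Fixpoint nostore (c : com) : bool :=
  match c with
  | CSkip | Asg _ _ => true
  | Store _ _ => false
  | CSeq c1 c2 | Cond _ c1 c2 => nostore c1 && nostore c2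
  | For _ _ b => nostore b
  end.

Lemma sem_nostore c s : nostore c -> Defs.mem (sem c s) = Defs.mem s.
Proof.
elim: c s => [|r e|a e|c1 IH1 c2 IH2|e c1 IH1 c2 IH2|r l b IHb] s //=.
- by case/andP=> h1 h2; rewrite IH2 // IH1.
- by case/andP=> h1 h2; case: ifP => _; rewrite ?IH1 ?IH2.
- by move=> h; elim: (regs s l) => [|m IHm] //=; rewrite IHb.
Qed.

Lemma sem_for (P : nat -> state -> Prop) r l b s :
  r \notin mods b -> P 0 (set_reg s r 0) ->
  (forall i s', i < regs s l -> regs s' r = i -> P i s' ->
     P i.+1 (incr r (sem b s'))) ->
  P (regs s l) (sem (For r l b) s).
Proof.
move=> rb P0 IH; rewrite /=; set m := regs s l in IH *.
suff h i : i <= m ->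
    regs (iter i (fun s => incr r (sem b s)) (set_reg s r 0)) r = i /\
    P i (iter i (fun s => incr r (sem b s)) (set_reg s r 0)).
  by case: (h m (leqnn m)).
elim: i => [|i IHi] im; first by rewrite /= /upd eqxx.
have [e p] := IHi (ltnW im); rewrite iterS; split; last exact: IH.
by rewrite /= /upd eqxx sem_frame // e.
Qed.

Lemma sem_for_ord n (A : Type) (R : nat -> state -> A -> Prop)
    (f : A -> 'I_n -> A) m0 r l b s :
  r \notin mods b -> regs s l = n -> R 0 (set_reg s r 0) m0 ->
  (forall (i : 'I_n) s' m, regs s' r = i -> R i s' m ->
     R i.+1 (incr r (sem b s')) (f m i)) ->
  R n (sem (For r l b) s) (foldl f m0 (enum 'I_n)).
Proof.
move=> rb ln R0 IH; pose P i s' := R i s' (foldl f m0 (take i (enum 'I_n))).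
have := @sem_for P r l b s rb; rewrite ln /P take0 => /(_ R0).
rewrite [take n _]take_oversize ?size_enum_ord //; apply=> i s' ilt e p.
rewrite (take_nth (Ordinal ilt)) ?size_enum_ord // foldl_rcons.
have -> : nth (Ordinal ilt) (enum 'I_n) i = Ordinal ilt.
  by apply: val_inj; rewrite /= nth_enum_ord.
exact: (IH (Ordinal ilt)).
Qed.

Lemma sem_seq c1 c2 s : sem (CSeq c1 c2) s = sem c2 (sem c1 s).
Proof. by []. Qed.
Lemma sem_asg r e s : sem (Asg r e) s = set_reg s r (eval s e).
Proof. by []. Qed.
Lemma sem_store a e s : sem (Store a e) s = store s (eval s a) (eval s e).
Proof. by []. Qed.
Lemma sem_cond e c1 c2 s :
  sem (Cond e c1 c2) s = if eval s e != 0 then sem c1 s else sem c2 s.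
Proof. by []. Qed.
Lemma sem_skip s : sem CSkip s = s.
Proof. by []. Qed.
Definition semE := (sem_seq, sem_asg, sem_store, sem_cond, sem_skip).

Arguments sem : simpl never.

Local Coercion Var : nat >-> expr.
Local Notation "a [+] b" := (Plus a b) (at level 50, left associativity).
Local Notation "a [-] b" := (Minus a b) (at level 50, left associativity).
Local Notation "c1 ;; c2" := (CSeq c1 c2) (at level 90, right associativity).
Local Notation "r <- e" := (Asg r e) (at level 80).
Local Notation "a <-- e" := (Store a e) (at level 80).

(* Registers 0 to 11 are fixed while one certificate is checked: they hold n, k,
   eta, n^2, n + 1, k + 1, the number of certificates, the number of tokens, the
   base addresses of the degree table and of the stack, and the admissible range
   of cluster sizes. *)
Local Notation rN := 0.
Local Notation rK := 1.
Local Notation rEta := 2.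
Local Notation rNN := 3.
Local Notation rN1 := 4.
Local Notation rK1 := 5.
Local Notation rZ := 6.
Local Notation rM := 7.
Local Notation rD := 8.
Local Notation rS := 9.
Local Notation rLo := 10.
Local Notation rHi := 11.
Local Notation rC := 12.
Local Notation rz := 13.
Local Notation rq := 14.
Local Notation rt := 15.
Local Notation rok := 16.
Local Notation ru := 17.
Local Notation ri := 18.
Local Notation rj := 19.
Local Notation rl := 20.
Local Notation rin := 21.
Local Notation rjn := 22.
Local Notation rln := 23.
Local Notation rr := 24.
Local Notation ra := 25.
Local Notation rp := 26.
Local Notation rpar := 27.
Local Notation rans := 28.
Local Notation rs := 29.
Local Notation rdg := 30.
Local Notation rtok := 31.

(** Division by 4 through repeated subtraction; [rz - 3] is nonzero exactly when [rz >= 4]. Since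
    certificates never exceed [rZ], that many rounds suffice. *)
Definition pop : com :=
  rq <- Cst 0;;
  For rt rZ (Cond (rz [-] Cst 3) (rz <- rz [-] Cst 4;; rq <- rq [+] Cst 1) CSkip);;
  rdg <- rz;;
  rz <- rq.

Lemma pop_sem s : regs s rz <= regs s rZ ->
  [/\ regs (sem pop s) rdg = regs s rz %% 4,
      regs (sem pop s) rz = regs s rz %/ 4 &
      Defs.mem (sem pop s) = Defs.mem s].
Proof.
move=> h; split; last exact: sem_nostore.
all: rewrite /pop !semE; set s0 := set_reg s rq _; set b := Cond _ _ _.
all: have := @sem_for (fun i s' => regs s' rq * 4 + regs s' rz = regs s rz /\
       (regs s' rz < 4 \/ regs s' rq = i)) rt rZ b s0.
all: case=> // [|i s' _ _ [e d]|e d].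
all: try (by split=> //=; right).
all: try (rewrite /b !semE /=; case: ifP => /= h'; rewrite /upd /=; split; lia).
all: have e0 : regs s0 rZ = regs s rZ by [].
all: set s1 := sem (For _ _ _) _ in e d *.
all: have r4 : regs s1 rz < 4 by rewrite e0 in d; lia.
all: rewrite /= /upd /= -e ?modnMDl ?divnMDl //.
  by rewrite modn_small.
by rewrite divn_small // addn0.
Qed.

(** Memory layout: the input matrix, a working copy of it at [n * n], the table of [n + 1] size
    counters at [2 * n * n], and above it the stack. *)
Definition fixed_regs (n k eta lo : nat) (r : nat) : nat :=
  nth 0 [:: n; k; eta; n * n; n.+1; k.+1; 2 ^ (32 * k); 32 * k; n * n + n * n;
    n * n + n * n + n.+1; lo; lo + eta] r.

Section Verifier.
Variables (n k eta lo : nat) (E0 : {set {set 'I_n}}).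
Notation nn := (n * n).

Definition frame (s : state) : Prop :=
  (forall r, r < 12 -> regs s r = fixed_regs n k eta lo r) /\
  (forall i j : 'I_n, Defs.mem s (i * n + j) = adj E0 i j).

Lemma frame_sem c s : all (fun r => 12 <= r) (mods c) -> nostore c ->
  frame s -> frame (sem c s).
Proof.
move=> /allP hm hs [h1 h2]; split=> [r r12|i j]; last by rewrite sem_nostore.
by rewrite sem_frame ?h1 //; apply/negP=> /hm; rewrite leqNgt r12.
Qed.

Lemma frame_set s r v : 12 <= r -> frame s -> frame (set_reg s r v).
Proof.
move=> r12 [h1 h2]; split=> // x x12; rewrite /= /upd ltn_eqF ?h1 //.
exact: leq_trans r12.
Qed.

Lemma ord_addr (x y : 'I_n) : x * n + y < nn.
Proof.
apply: (@leq_trans (x.+1 * n)); first by rewrite mulSn addnC ltn_add2r.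
by rewrite leq_mul2r ltn_ord orbT.
Qed.

Lemma frame_store s a v : nn <= a -> frame s -> frame (store s a v).
Proof.
move=> ha [h1 h2]; split=> // i j; rewrite /= /upd ltn_eqF ?h2 //.
exact: leq_trans (ord_addr i j) ha.
Qed.

Definition matrix_at (s : state) (E : {set {set 'I_n}}) : Prop :=
  forall i j : 'I_n, Defs.mem s (nn + i * n + j) = adj E i j.

Definition rep1 (s : state) (st : bstate n) : Prop :=
  let: (E, z, u) := st in
  [/\ frame s, matrix_at s E, regs s rz = z, regs s ru = u & z <= 2 ^ (32 * k)].

Lemma addr_eq (x y i j : 'I_n) : (nn + x * n + y == nn + i * n + j) =
  (x == i) && (y == j).
Proof.
have n0 : 0 < n := leq_ltn_trans (leq0n x) (ltn_ord x).
rewrite -!addnA eqn_add2l; apply/eqP/andP => [e|[/eqP -> /eqP ->] //].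
have := congr1 (divn^~ n) e; have := congr1 (modn^~ n) e.
rewrite /= !modnMDl !divnMDl // !modn_small // !divn_small // !addn0 => e1 e2.
by split; apply/eqP/val_inj.
Qed.

Lemma set2_eq (x y i j : 'I_n) : ([set x; y] == [set i; j]) =
  ((x == i) && (y == j)) || ((x == j) && (y == i)).
Proof.
apply/eqP/orP => [e|[/andP[/eqP -> /eqP ->]|/andP[/eqP -> /eqP ->]]] //; last first.
  by rewrite setUC.
have hx : x \in [set i; j] by rewrite -e set21.
have hy : y \in [set i; j] by rewrite -e set22.
have hi : i \in [set x; y] by rewrite e set21.
have hj : j \in [set x; y] by rewrite e set22.
move: hx hy hi hj; rewrite !inE [i == x]eq_sym [i == y]eq_sym [j == x]eq_sym.
rewrite [j == y]eq_sym.
by case: (x == i); case: (x == j); case: (y == i); case: (y == j); auto.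
Qed.

Lemma matrix_at_set s E E' (i j : 'I_n) (b : bool) : matrix_at s E ->
  (forall x y, adj E' x y = if [set x; y] == [set i; j] then b else adj E x y) ->
  matrix_at (store (store s (nn + i * n + j) b) (nn + j * n + i) b) E'.
Proof.
move=> h hE x y; rewrite /= /upd !addr_eq hE set2_eq h.
by do 2!case: andP; rewrite ?orbT.
Qed.

(** Three values that are 0 or 1 have a sum above 2 only if all are 1, so one truncated subtraction
    tests for an induced path. *)
Definition branch : com :=
  Cond (ri [-] rl)
    (Cond (Fetch (rin [+] rj) [+] Fetch (rjn [+] rl) [+]
           (Cst 1 [-] Fetch (rin [+] rl)) [-] Cst 2)
       (pop;; ru <- ru [+] Cst 1;;
        Cond rdg
          (Cond (rdg [-] Cst 1)
             (rin [+] rl <-- Cst 1;; rln [+] ri <-- Cst 1)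
             (rjn [+] rl <-- Cst 0;; rln [+] rj <-- Cst 0))
          (rin [+] rj <-- Cst 0;; rjn [+] ri <-- Cst 0))
       CSkip)
    CSkip.

Lemma branch_sem s st (i l j : 'I_n) : rep1 s st ->
  regs s ri = i -> regs s rl = l -> regs s rj = j ->
  regs s rin = nn + i * n -> regs s rln = nn + l * n -> regs s rjn = nn + j * n ->
  rep1 (sem branch s) (bstep st i l j).
Proof.
case: st => [[E z] u] [fr mx ez eu zb] ei el ej ein eln ejn.
rewrite /branch !(sem_cond, sem_skip) /= ei el ej ein ejn !mx /p3.
case: ltnP => li; last by rewrite (eqP (_ : i - l == 0)) ?subn_eq0.
have -> /= : i - l != 0 by rewrite subn_eq0 -ltnNge.
case: (adj E i j); case: (adj E j l); case: (adj E i l) => //=.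
have zZ : regs s rz <= regs s rZ by rewrite ez (proj1 fr rZ isT).
have [pd pz pm] := pop_sem zZ; rewrite ez in pd pz.
have fr1 : frame (sem pop s) by apply: frame_sem.
have keep r : r \notin mods pop -> regs (sem pop s) r = regs s r.
  by apply: sem_frame.
have mx1 : matrix_at (sem pop s) E by move=> x y; rewrite pm.
rewrite sem_seq; move: pd pz pm fr1 mx1.
rewrite -(keep ru isT) in eu; rewrite -(keep ri isT) in ei.
rewrite -(keep rl isT) in el; rewrite -(keep rj isT) in ej.
rewrite -(keep rin isT) in ein; rewrite -(keep rln isT) in eln.
rewrite -(keep rjn isT) in ejn.
move: (sem pop s) {keep} eu ei el ej ein eln ejn => s1 eu ei el ej ein eln ejn.
move=> pd pz pm fr1 mx1; rewrite !semE /= /upd /= pd.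
set s2 := set_reg s1 ru _; have fr2 : frame s2 by apply: frame_set.
have mx2 : matrix_at s2 E by [].
have rest E' (i' j' : 'I_n) (b : bool) :
    (forall x y, adj E' x y = if [set x; y] == [set i'; j'] then b else adj E x y) ->
    rep1 (store (store s2 (nn + i' * n + j') b) (nn + j' * n + i') b)
      (E', z %/ 4, u.+1).
  move=> hE'; split=> /=.
  - by do 2!(apply: frame_store; first by rewrite -addnA leq_addr).
  - exact: (matrix_at_set mx2).
  - by rewrite /upd /= pz.
  - by rewrite /upd /= eu addn1.
  - exact: leq_trans (leq_div _ _) zb.
have del (i' j' : 'I_n) : forall x y, adj (E :\ [set i'; j']) x y =
    if [set x; y] == [set i'; j'] then false else adj E x y.
  by move=> x y; rewrite /adj in_setD1; case: eqP.
have ins (i' j' : 'I_n) : forall x y, adj ([set i'; j'] |: E) x y =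
    if [set x; y] == [set i'; j'] then true else adj E x y.
  by move=> x y; rewrite /adj in_setU1; case: eqP.
case: (z %% 4) => [|[|m]]; rewrite !(ei, el, ej, ein, eln, ejn).
- exact: (rest _ _ _ _ (del i j)).
- exact: (rest _ _ _ _ (del j l)).
- exact: (rest _ _ _ _ (ins i l)).
Qed.

Lemma rep1_set s st r v : 12 <= r -> r != rz -> r != ru ->
  rep1 s st -> rep1 (set_reg s r v) st.
Proof.
move=> r12 nz nu; case: st => [[E z] u] [fr mx ez eu zb]; split=> //.
- exact: frame_set.
- by rewrite /= /upd eq_sym (negbTE nz).
- by rewrite /= /upd eq_sym (negbTE nu).
Qed.

Lemma rep1_frame s st : rep1 s st -> frame s.
Proof. by case: st => [[E z] u] []. Qed.

(** Without multiplication, the row address of each index is advanced by [n] along with its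
    counter. *)
Definition branch_j : com := rjn <- rNN;; For rj rN (branch;; rjn <- rjn [+] rN).
Definition branch_l : com := rln <- rNN;; For rl rN (branch_j;; rln <- rln [+] rN).
Definition branch_i : com := rin <- rNN;; For ri rN (branch_l;; rin <- rin [+] rN).
Definition branching : com := For rr rK1 branch_i.

Lemma branch_j_sem s st (i l : 'I_n) : rep1 s st ->
  regs s ri = i -> regs s rl = l ->
  regs s rin = nn + i * n -> regs s rln = nn + l * n ->
  rep1 (sem branch_j s) (foldl (fun st j => bstep st i l j) st (enum 'I_n)).
Proof.
move=> h ei el ein eln; rewrite /branch_j sem_seq sem_asg /=.
pose R j s' st' := [/\ rep1 s' st', regs s' ri = i, regs s' rl = l,
  regs s' rin = nn + i * n & regs s' rln = nn + l * n /\ regs s' rjn = nn + j * n].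
have fr := proj1 (rep1_frame h).
suff : R n (sem (For rj rN (branch;; rjn <- rjn [+] rN)) (set_reg s rjn (regs s rNN)))
    (foldl (fun st j => bstep st i l j) st (enum 'I_n)) by case.
apply: sem_for_ord => //; first by rewrite /= /upd /= (fr rN isT).
  split=> //; first by do 2!(apply: rep1_set => //).
  by rewrite /= /upd /= (fr rNN isT) ?mul0n addn0.
move=> j s' st' ej [h' ei' el' ein' [eln' ejn']]; rewrite sem_seq sem_asg.
have h2 := branch_sem h' ei' el' ej ein' eln' ejn'.
have fr2 := proj1 (rep1_frame h2).
split=> //; first by do 2!(apply: rep1_set => //).
- by rewrite /= /upd /= sem_frame.
- by rewrite /= /upd /= sem_frame.
- by rewrite /= /upd /= sem_frame.
- rewrite /= /upd /= sem_frame // (fr2 rN isT).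
  rewrite [regs (sem branch s') rjn]sem_frame // ejn'.
  by split=> //; rewrite mulSn -addnA [n + _]addnC.
Qed.

Lemma branch_l_sem s st (i : 'I_n) : rep1 s st ->
  regs s ri = i -> regs s rin = nn + i * n ->
  rep1 (sem branch_l s) (foldl (fun st l => foldl (fun st j => bstep st i l j)
    st (enum 'I_n)) st (enum 'I_n)).
Proof.
move=> h ei ein; rewrite /branch_l sem_seq sem_asg /=.
pose R l s' st' := [/\ rep1 s' st', regs s' ri = i,
  regs s' rin = nn + i * n & regs s' rln = nn + l * n].
have fr := proj1 (rep1_frame h).
suff : R n (sem (For rl rN (branch_j;; rln <- rln [+] rN)) (set_reg s rln (regs s rNN)))
    (foldl (fun st l => foldl (fun st j => bstep st i l j) st (enum 'I_n))
      st (enum 'I_n)) by case.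
apply: sem_for_ord => //; first by rewrite /= /upd /= (fr rN isT).
  split=> //; first by do 2!(apply: rep1_set => //).
  by rewrite /= /upd /= (fr rNN isT) ?mul0n addn0.
move=> l s' st' el [h' ei' ein' eln']; rewrite sem_seq sem_asg.
have h2 := branch_j_sem h' ei' el ein' eln'.
have fr2 := proj1 (rep1_frame h2).
split=> //; first by do 2!(apply: rep1_set => //).
- by rewrite /= /upd /= sem_frame.
- by rewrite /= /upd /= sem_frame.
- rewrite /= /upd /= (fr2 rN isT) [regs (sem branch_j s') rln]sem_frame // eln'.
  by rewrite mulSn -addnA [n + _]addnC.
Qed.

Lemma branch_i_sem s st : rep1 s st -> rep1 (sem branch_i s) (bround st).
Proof.
move=> h; rewrite /branch_i sem_seq sem_asg /=.
pose R i s' st' := rep1 s' st' /\ regs s' rin = nn + i * n.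
have fr := proj1 (rep1_frame h).
suff : R n (sem (For ri rN (branch_l;; rin <- rin [+] rN)) (set_reg s rin (regs s rNN)))
    (bround st) by case.
apply: sem_for_ord => //; first by rewrite /= /upd /= (fr rN isT).
  split=> //; first by do 2!(apply: rep1_set => //).
  by rewrite /= /upd /= (fr rNN isT) ?mul0n addn0.
move=> i s' st' ei [h' ein']; rewrite sem_seq sem_asg.
have h2 := branch_l_sem h' ei ein'; have fr2 := proj1 (rep1_frame h2).
split=> //; first by do 2!(apply: rep1_set => //).
rewrite /= /upd /= (fr2 rN isT) [regs (sem branch_l s') rin]sem_frame // ein'.
by rewrite mulSn -addnA [n + _]addnC.
Qed.

Lemma branching_sem s st : rep1 s st ->
  rep1 (sem branching s) (iter k.+1 (@bround n) st).
Proof.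
move=> h; have fr := proj1 (rep1_frame h).
have := @sem_for (fun i s' => rep1 s' (iter i (@bround n) st)) rr rK1 branch_i s isT.
rewrite (fr rK1 isT); apply; first exact: rep1_set.
by move=> i s' _ _ h'; apply: rep1_set => //; apply: branch_i_sem.
Qed.

(** * Working copy of the matrix and table of component sizes *)

Definition copy : com := For ra rNN (rNN [+] ra <-- Fetch ra).

Lemma copy_sem s : frame s -> frame (sem copy s) /\ matrix_at (sem copy s) E0.
Proof.
move=> h; pose P i s' := frame s' /\ forall x y : 'I_n, x * n + y < i ->
  Defs.mem s' (nn + x * n + y) = adj E0 x y.
have := @sem_for P ra rNN (rNN [+] ra <-- Fetch ra) s isT.
rewrite (proj1 h rNN isT) => -[||fr mx].
- by split; [exact: frame_set | ].
- move=> i s' _ ei [fr mx]; rewrite sem_store /= ei (proj1 fr rNN isT).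
  split; first by apply: frame_set => //; apply: frame_store; rewrite // leq_addr.
  move=> x y xy; rewrite /= /upd -addnA eqn_add2l; case: eqP => [<-|ne].
    exact: (proj2 fr).
  by rewrite addnA mx //; lia.
- by split=> // x y; apply: mx; apply: ord_addr.
Qed.

Lemma matrix_at_store s E a v : nn + nn <= a -> matrix_at s E ->
  matrix_at (store s a v) E.
Proof.
move=> ha h x y; rewrite /= /upd ltn_eqF ?h // (leq_trans _ ha) // -addnA ltn_add2l.
exact: ord_addr.
Qed.

(** Counting starts at 1: the component size includes the vertex itself. *)
Definition degree : com :=
  rq <- Cst 1;; For rj rN (rq <- rq [+] Fetch (rin [+] rj)).
Definition degrees : com :=
  For rs rN1 (rD [+] rs <-- Cst 0);;
  rin <- rNN;;
  For ri rN (degree;; rD [+] rq <-- Fetch (rD [+] rq) [+] Cst 1;; rin <- rin [+] rN).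

Lemma foldl_addn (A : Type) (f : A -> nat) xs q :
  foldl (fun q x => q + f x) q xs = q + \sum_(x <- xs) f x.
Proof.
elim: xs q => [|x xs IH] q /=; first by rewrite big_nil addn0.
by rewrite IH big_cons addnA.
Qed.

Lemma degree_sem s E (i : 'I_n) : frame s -> matrix_at s E ->
  regs s rin = nn + i * n ->
  regs (sem degree s) rq = #|[set y | adj E i y]|.+1.
Proof.
move=> fr mx ein; rewrite /degree sem_seq sem_asg /=.
pose R (j : nat) s' q := [/\ regs s' rq = q, regs s' rin = nn + i * n &
  Defs.mem s' = Defs.mem s].
have : R n (sem (For rj rN (rq <- rq [+] Fetch (rin [+] rj))) (set_reg s rq 1))
    (foldl (fun q j => q + adj E i j) 1 (enum 'I_n)).
  apply: sem_for_ord => //; first by rewrite /= /upd /= (proj1 fr rN isT).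
  move=> j s' q ej [eq1 ein1 em1]; rewrite sem_asg /= eq1 ein1 ej em1 mx.
  by split; rewrite /= /upd.
case=> -> _ _; rewrite foldl_addn add1n big_enum /=; congr _.+1.
rewrite -sum1_card [RHS]big_mkcond; apply: eq_bigr => y _.
by rewrite inE; case: (adj _ _ _).
Qed.

Lemma foldl_upd_count (A : Type) (d : A -> nat) xs N t :
  foldl (fun N v => upd N (d v) (N (d v)).+1) N xs t =
  N t + count (fun v => d v == t) xs.
Proof.
elim: xs N => [|x xs IH] N /=; first by rewrite addn0.
rewrite IH /upd eq_sym; case: eqP => [->|_] /=; last by [].
by rewrite addSnnS.
Qed.

Lemma degrees_sem s E : frame s -> matrix_at s E ->
  frame (sem degrees s) /\
  forall t, t <= n -> Defs.mem (sem degrees s) (nn + nn + t) = degree_count E t.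
Proof.
move=> fr mx; rewrite /degrees !sem_seq sem_asg.
set s1 := sem (For rs _ _) s.
have [fr1 mx1 tb1] : [/\ frame s1, matrix_at s1 E &
    forall t, t < n.+1 -> Defs.mem s1 (nn + nn + t) = 0].
  pose P i s' := [/\ frame s', matrix_at s' E &
    forall t, t < i -> Defs.mem s' (nn + nn + t) = 0].
  have := @sem_for P rs rN1 (rD [+] rs <-- Cst 0) s isT.
  rewrite (proj1 fr rN1 isT); apply; first by split=> //; apply: frame_set.
  move=> i s' _ ei [f m tb]; rewrite sem_store /= ei (proj1 f rD isT).
  split.
  - by apply: frame_set => //; apply: frame_store; rewrite // -addnA leq_addr.
  - by apply: (@matrix_at_store s'); rewrite // leq_addr.
  - move=> t ti; rewrite /= /upd eqn_add2l; case: eqP => // ne.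
    by apply: tb; lia.
pose d (v : 'I_n) := #|[set y | adj E v y]|.+1.
pose R i s' (N : nat -> nat) := [/\ frame s', matrix_at s' E,
   regs s' rin = nn + i * n & forall t, t <= n -> Defs.mem s' (nn + nn + t) = N t].
set b := (degree;; _); set s2 := set_reg s1 _ _.
have : R n (sem (For ri rN b) s2)
    (foldl (fun N v => upd N (d v) (N (d v)).+1) (fun=> 0) (enum 'I_n)).
  apply: sem_for_ord => //; first by rewrite /= /upd /= (proj1 fr1 rN isT).
    split=> //; first by do 2!(apply: frame_set => //).
    by rewrite /= /upd /= (proj1 fr1 rNN isT) ?mul0n addn0.
  move=> i s' N ei [f m ein tb]; rewrite /b sem_seq.
  have fr3 : frame (sem degree s') by apply: frame_sem.
  have mm : Defs.mem (sem degree s') = Defs.mem s' by apply: sem_nostore.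
  have mx3 : matrix_at (sem degree s') E by move=> x y; rewrite mm.
  have ein3 : regs (sem degree s') rin = nn + i * n by rewrite sem_frame.
  have dq := degree_sem f m ein; rewrite -/(d i) in dq.
  move: (sem degree s') fr3 mm mx3 ein3 dq => s3 fr3 mm mx3 ein3 dq.
  rewrite !semE /= /upd /= dq ein3 (proj1 fr3 rD isT) (proj1 fr3 rN isT).
  split.
  - do 2!(apply: frame_set => //); apply: frame_store => //.
    by rewrite -addnA leq_addr.
  - by apply: (@matrix_at_store s3); rewrite // leq_addr.
  - by rewrite /= /upd /= mulSn -addnA [n + _]addnC.
  - move=> t tn; rewrite /= /upd /= eqn_add2l mm; case: eqP => [<-|_].
      by rewrite tb // addn1.
    exact: tb.
case=> f m _ tb; split=> // t tn; rewrite tb //.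
rewrite foldl_upd_count add0n -sum1_count big_enum_cond /=.
by rewrite /degree_count -sum1dep_card; apply: eq_bigl => v.
Qed.

(** Only sizes up to [n] have a cell, hence the test [s <= n] in [mstep]. *)
Definition table_at (m : nat -> nat) (N : nat -> nat) : Prop :=
  forall t, t <= n -> m (nn + nn + t) = N t.

(** * The stack machine in memory *)

Notation base := (nn + nn + n.+1).

Fixpoint stack_at (m : nat -> nat) (stk : seq (nat * nat)) : Prop :=
  if stk is (v, x) :: stk' then
    [/\ m (base + 2 * size stk') = v, m (base + 2 * size stk' + 1) = x &
        stack_at m stk']
  else True.

Lemma stack_at_upd m stk a v : base + 2 * size stk <= a ->
  stack_at m stk -> stack_at (upd m a v) stk.
Proof.
elim: stk => [|[s x] stk IH] //= ha [h1 h2 h3].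
by split; [rewrite /upd ltn_eqF ?h1 //; lia | rewrite /upd ltn_eqF ?h2 //; lia |
  apply: IH => //; lia].
Qed.

Lemma stack_at_upd_low m stk a v : a < base ->
  stack_at m stk -> stack_at (upd m a v) stk.
Proof.
elim: stk => [|[s x] stk IH] //= ha [h1 h2 h3].
by split; [rewrite /upd gtn_eqF ?h1 //; lia | rewrite /upd gtn_eqF ?h2 //; lia |
  apply: IH => //; lia].
Qed.

Lemma table_at_upd m N a v : base <= a -> table_at m N -> table_at (upd m a v) N.
Proof.
by move=> ha h t tn; rewrite /upd ltn_eqF ?h // (leq_trans _ ha) // ltn_add2l ltnS.
Qed.

(** [rp] is the address of the top entry. [rpar] is flipped at every push and pop, so the kind of a
    node is known without computing a parity. After a failure only [rok] matters. *)
Definition rep2 (s : state) (st : option config) (z : nat) : Prop :=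
  [/\ frame s, regs s rz = z, z <= 2 ^ (32 * k) &
    if st is Some (stk, N, c) then
      [/\ regs s rok = 1, stk != [::], stack_at (Defs.mem s) stk,
          table_at (Defs.mem s) N & [/\ regs s ru = c,
          regs s rp = base + 2 * (size stk).-1 & regs s rpar = odd (size stk).-1]]
    else regs s rok = 0].

Definition mopen : com :=
  rp <- rp [+] Cst 2;; rpar <- Cst 1 [-] rpar;; rp <-- Cst 0;; rp [+] Cst 1 <-- Cst 0.

Definition mfail : com := rok <- Cst 0.

(** A sum of truncated differences vanishes exactly when all the inequalities hold, so it serves as
    a conjunction of comparisons. *)
Definition mclose : com :=
  Cond (rp [-] rS)
    (rs <- Fetch rp;;
     Cond rpar
       (Cond ((rs [-] rN) [+] (rs [-] Fetch (rD [+] rs)))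
          mfail
          (rD [+] rs <-- Fetch (rD [+] rs) [-] rs;;
           rp <- rp [-] Cst 2;; rpar <- Cst 1 [-] rpar))
       (Cond ((rLo [-] rs) [+] (rs [-] rHi))
          mfail
          (rp <- rp [-] Cst 2;; rpar <- Cst 1 [-] rpar)))
    mfail.

Definition munit : com :=
  Cond (rp [-] rS)
    (ru <- ru [+] (Fetch rp [+] Fetch (rp [-] Cst 2) [-]
             (Fetch (rp [+] Cst 1) [+] Fetch (rp [+] Cst 1)));;
     rp <-- Fetch rp [+] Cst 1;;
     rp [+] Cst 1 <-- Fetch (rp [+] Cst 1) [+] Cst 1;;
     rp [-] Cst 2 <-- Fetch (rp [-] Cst 2) [+] Cst 1)
    mfail.

Definition mtoken : com :=
  pop;;
  Cond rok
    (Cond rdg (Cond (rdg [-] Cst 1) (Cond (rdg [-] Cst 2) munit mclose) mopen) CSkip)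
    CSkip.

Lemma mfail_sem s st z : rep2 s st z -> rep2 (sem mfail s) None z.
Proof. by case=> fr ez zb _; split=> //; apply: frame_set. Qed.

Lemma mopen_sem s stk N c z : rep2 s (Some (stk, N, c)) z ->
  rep2 (sem mopen s) (Some ((0, 0) :: stk, N, c)) z.
Proof.
case=> fr ez zb [ok ne sk tb [eu ep epar]]; rewrite /mopen !semE /= /upd /= ep.
have sp : 0 < size stk by case: (stk) ne.
have -> : base + 2 * (size stk).-1 + 2 = base + 2 * size stk by lia.
split=> //.
- apply: frame_store; first by clear; lia.
  apply: frame_store; first by clear; lia.
  by do 2!(apply: frame_set => //).
- split=> //=.
  + split; first by rewrite /upd eqn_add2l; case: eqP => //; rewrite eqxx; lia.
    * by rewrite /upd eqxx.
    * by apply: stack_at_upd; [lia | apply: stack_at_upd].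
  + by do 2!(apply: table_at_upd; first by lia).
  + split=> //; rewrite /upd /= epar; case: (stk) sp => //= a t _.
    by case: (odd _).
Qed.

Lemma mclose_sem s stk N c z : rep2 s (Some (stk, N, c)) z ->
  rep2 (sem mclose s) (mstep n lo (lo + eta) (Some (stk, N, c)) 2) z.
Proof.
move=> h; have hf := mfail_sem h; move: h hf.
case=> fr ez zb [ok ne sk tb [eu ep epar]] hf.
case: stk ne sk ep epar hf => [|[v x] [|y stk]] // _ sk ep epar hf.
  rewrite /mclose sem_cond /= ep (proj1 fr rS isT) /fixed_regs /= muln0 addn0 subnn.
  exact: hf.
rewrite /= in epar; case: sk => e1 e2 sk.
rewrite /mclose sem_cond /= ep (proj1 fr rS isT) /fixed_regs /=.
rewrite addKn muln_eq0 /= sem_seq sem_asg /= ep e1 sem_cond /= {1}/upd /= epar /=.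
have fr1 : frame (set_reg s rs v) by apply: frame_set.
have hf1 : rep2 (sem mfail (set_reg s rs v)) None z.
  by split=> //; apply: frame_set.
have eD : regs s rD = nn + nn := proj1 fr rD isT.
case: (boolP (odd (size stk))) => od /=; last first.
  rewrite sem_cond /= /upd /= (proj1 fr rN isT) eD.
  rewrite addn_eq0 !subn_eq0; case: (boolP (v <= n)) => vn; last by exact: hf1.
  rewrite tb //=; case: (boolP (v <= N v)) => vN; last by rewrite /=; exact: hf1.
  rewrite /= !semE /= /upd /= eD tb // ep epar (negbTE od).
  split=> //.
  - do 2!(apply: frame_set => //); apply: frame_store => //.
    by rewrite -addnA leq_addr.
  - split=> //=.
    + by apply: (@stack_at_upd_low _ (y :: stk)) => //; lia.
    + by move=> t tn; rewrite /upd eqn_add2l tb.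
    + by split=> //=; rewrite /upd /= ?(negbTE od) //; lia.
rewrite sem_cond /= /upd /= (proj1 fr rLo isT) (proj1 fr rHi isT) /fixed_regs /=.
rewrite addn_eq0 !subn_eq0; case: (boolP (lo <= v <= lo + eta)) => vb /=; last first.
  exact: hf1.
rewrite !semE /= /upd /= ep epar od.
split=> //; first by do 2!(apply: frame_set => //).
by split=> //=; split=> //=; rewrite /upd /= ?od //; lia.
Qed.

Lemma munit_sem s stk N c z : rep2 s (Some (stk, N, c)) z ->
  rep2 (sem munit s) (mstep n lo (lo + eta) (Some (stk, N, c)) 3) z.
Proof.
move=> h; have hf := mfail_sem h; move: h hf.
case=> fr ez zb [ok ne sk tb [eu ep epar]] hf.
case: stk ne sk ep epar hf => [|[v x] [|[v' x'] stk]] // _ sk ep epar hf.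
  rewrite /munit sem_cond /= ep (proj1 fr rS isT) /fixed_regs /= muln0 addn0 subnn.
  exact: hf.
case: sk => e1 e2 [e3 e4 sk]; rewrite /munit sem_cond /= ep (proj1 fr rS isT).
rewrite /fixed_regs /= addKn muln_eq0 /= !semE /= /upd /= ep.
rewrite [size ((v', x') :: stk)]/= in e1 e2 *; rewrite [(size _).-1]/= in ep *.
have -> : base + 2 * (size stk).+1 - 2 = base + 2 * size stk by lia.
set p := base + 2 * size stk in e3 e4 *.
have pp : base + 2 * (size stk).+1 = p + 2 by rewrite /p; lia.
rewrite pp in e1 e2 ep *.
have q1 : (p + 2 + 1 == p + 2) = false by lia.
have q2 : (p == p + 2 + 1) = false by lia.
have q3 : (p == p + 2) = false by lia.
rewrite q1 q2 q3 e1 e2 e3.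
have pb : base <= p by rewrite /p; lia.
split=> //.
- by do 3!(apply: frame_store; first by move: pb; lia); apply: frame_set.
- split=> //.
  + split; rewrite ?[size ((v'.+1, x') :: stk)]/= ?pp.
    * by rewrite /= /upd; do 3?[case: eqP => ?]; lia.
    * by rewrite /= /upd; do 3?[case: eqP => ?]; lia.
    * split; first by rewrite /= /upd eqxx addn1.
        by rewrite /= /upd; do 3?[case: eqP => ?]; rewrite ?e4; lia.
      apply: stack_at_upd; first by rewrite /p.
      by do 2!(apply: stack_at_upd; first by rewrite /p; lia).
  + by do 3!(apply: table_at_upd; first by lia).
  + split=> //=; rewrite /upd /=; last by rewrite ep /p; lia.
    by rewrite eu; congr (_ + _); lia.
Qed.

Lemma mtoken_sem s st z : rep2 s st z ->
  rep2 (sem mtoken s) (mstep n lo (lo + eta) st (z %% 4)) (z %/ 4).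
Proof.
move=> h; case: (h) => fr ez zb hst; rewrite /mtoken sem_seq.
have zZ : regs s rz <= regs s rZ by rewrite ez (proj1 fr rZ isT).
have [pd pz pm] := pop_sem zZ; rewrite ez in pd pz.
have {}h : rep2 (sem pop s) st (z %/ 4).
  split=> //; first exact: frame_sem; first exact: leq_trans (leq_div _ _) zb.
  case: st hst {h} => [[[stk N] c]|]; last by rewrite sem_frame.
  by rewrite pm !sem_frame.
move: (sem pop s) pd h => s1 pd h; have z4 : z %% 4 < 4 by rewrite ltn_mod.
case: st h {hst} => [[[stk N] c]|] h; last first.
  by case: (h) => _ _ _ ok; rewrite !semE /= ok.
case: (h) => _ _ _ [ok _ _ _ _]; rewrite !semE /= ok pd /=.
case: (z %% 4) z4 => [|[|[|[|m]]]] // _ /=.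
- exact: mopen_sem.
- exact: mclose_sem.
- exact: munit_sem.
Qed.

Definition machine : com :=
  rok <- Cst 1;; rp <- rS;; rpar <- Cst 0;; rp <-- Cst 0;; rp [+] Cst 1 <-- Cst 0;;
  For rtok rM mtoken.

Lemma rep2_set s st z r v : 12 <= r -> r \notin [:: rz; rok; ru; rp; rpar] ->
  rep2 s st z -> rep2 (set_reg s r v) st z.
Proof.
rewrite !inE !negb_or => r12 /and5P[n1 n2 n3 n4 n5] [fr ez zb h].
split=> //; first exact: frame_set.
  by rewrite /= /upd eq_sym (negbTE n1).
case: st h => [[[stk N] c]|] /=; rewrite /upd ![_ == r]eq_sym (negbTE n2) //.
by rewrite (negbTE n3) (negbTE n4) (negbTE n5).
Qed.

Lemma machine_sem s N z : frame s -> table_at (Defs.mem s) N -> regs s rz = z ->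
  z <= 2 ^ (32 * k) -> exists z', rep2 (sem machine s)
    (foldl (mstep n lo (lo + eta)) (Some ([:: (0, 0)], N, regs s ru))
      (digits (32 * k) z)) z'.
Proof.
move=> fr tb ez zb; set st0 := Some _; set res := foldl _ _ _.
rewrite /machine !sem_seq; set s1 := sem (_ [+] _ <-- _) _.
have h1 : rep2 s1 st0 z.
  rewrite /s1 !semE /= /upd /= (proj1 fr rS isT) /fixed_regs /=.
  split=> //.
    apply: frame_store; first by lia.
    apply: frame_store; first by lia.
    by do 3!(apply: frame_set => //).
  split=> //=.
  - by split=> //; rewrite /upd muln0 addn0; do 2?[case: eqP => ?]; lia.
  - by do 2!(apply: table_at_upd; first by lia).
  - by rewrite /upd /= muln0 addn0.
pose P i s' := exists st' z', rep2 s' st' z' /\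
  foldl (mstep n lo (lo + eta)) st' (digits (32 * k - i) z') = res.
have eM : regs s1 rM = 32 * k by case: h1 => f _ _ _; exact: (proj1 f rM isT).
have := @sem_for P rtok rM mtoken s1 isT; rewrite eM => -[||st' [z' [h' e']]].
- by exists st0, z; split; [exact: rep2_set | rewrite subn0].
- move=> i s' im ei [st' [z' [h' e']]].
  exists (mstep n lo (lo + eta) st' (z' %% 4)), (z' %/ 4); split.
    by apply: rep2_set => //; apply: mtoken_sem.
  by rewrite -e' (_ : 32 * k - i = (32 * k - i.+1).+1) //; lia.
- by exists z'; move: e'; rewrite subnn /= => <-.
Qed.

(** Tests can only clear [rok], so in sequence they form a conjunction, and an earlier failure
    persists. *)
Definition accept : com :=
  Cond (rp [-] rS) mfail CSkip;;
  Cond (Fetch rS) mfail CSkip;;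
  Cond (ru [-] rK) mfail CSkip;;
  For rs rN1 (Cond (Fetch (rD [+] rs))
    (Cond ((rLo [-] rs) [+] (rs [-] rHi)) mfail CSkip) CSkip).

Lemma accept_sem s st z : rep2 s st z -> frame (sem accept s) /\
  regs (sem accept s) rok = maccept n lo (lo + eta) k st.
Proof.
case=> fr _ _ h; split; first exact: frame_sem.
pose F s' (b : bool) := [/\ frame s', Defs.mem s' = Defs.mem s,
  regs s' rp = regs s rp, regs s' ru = regs s ru & regs s' rok = b].
have step e s' (b : bool) : F s' b ->
    F (sem (Cond e mfail CSkip) s') (b && (eval s' e == 0)).
  case=> f1 f2 f3 f4 f5; rewrite !sem_cond /mfail sem_skip sem_asg.
  case: eqP => _ /=; last by rewrite andbF; split=> //; apply: frame_set.
  by rewrite andbT.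
set ok0 : bool := if st is Some _ then true else false.
have F0 : F s ok0.
  by split=> //; move: h; rewrite /ok0; case: (st) => [[[stk N] c] []|].
rewrite /accept !sem_seq.
have F1 := step (rp [-] rS) _ _ F0; move: (sem _ s) F1 => s1 F1.
have F2 := step (Fetch rS) _ _ F1; move: (sem _ s1) F2 => s2 F2.
have F3 := step (ru [-] rK) _ _ F2; move: (sem _ s2) F3 => s3 F3.
set b3 := andb _ _ in F3.
have := @sem_for (fun i s' => F s' (b3 && all (fun t =>
   (Defs.mem s (nn + nn + t) == 0) || (lo <= t <= lo + eta)) (iota 0 i)))
   rs rN1 (Cond (Fetch (rD [+] rs))
    (Cond ((rLo [-] rs) [+] (rs [-] rHi)) mfail CSkip) CSkip) s3 isT.
have -> : regs s3 rN1 = n.+1 by case: F3 => f _ _ _ _; exact: (proj1 f rN1 isT).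
case.
- rewrite /= andbT; case: F3 => f1 f2 f3 f4 f5; split=> //; exact: frame_set.
- move=> i s' im ei FF; case: (FF) => f1 f2 f3 f4 f5.
  have G s4 b : F s4 b -> F (incr rs s4) b.
    by case=> g1 g2 g3 g4 g5; split=> //; apply: frame_set.
  rewrite -[in iota 0 i.+1]addn1 iotaD all_cat /= andbT andbA add0n sem_cond.
  rewrite /eval -/eval ei (proj1 f1 rD isT) f2.
  case: eqP => /= [_|_]; first by rewrite andbT; apply: G.
  have := step ((rLo [-] rs) [+] (rs [-] rHi)) _ _ FF.
  rewrite /eval -/eval ei (proj1 f1 rLo isT) (proj1 f1 rHi isT) /fixed_regs /=.
  by rewrite addn_eq0 !subn_eq0; apply: G.
move=> _ _ _ _ ->; congr nat_of_bool; rewrite /b3 /maccept {b3 F3}.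
have allE N : table_at (Defs.mem s) N ->
    all (fun t => (Defs.mem s (nn + nn + t) == 0) || (lo <= t <= lo + eta))
      (iota 0 n.+1) =
    all (fun t => (N t == 0) || (lo <= t <= lo + eta)) (iota 0 n.+1).
  move=> tb; apply: eq_in_all => t; rewrite mem_iota ltnS => /andP[_ tn].
  by rewrite tb.
move: (iota 0 n.+1) allE => io allE.
case: F1 => f1 m1 p1 u1 _; case: F2 => f2 m2 p2 u2 _ {F0 step}; rewrite /=.
rewrite (proj1 fr rS isT) (proj1 f1 rS isT) (proj1 f2 rK isT) m1 u2.
case: st @ok0 h => [[[stk N] c]|] //= [_ ne sk tb [-> -> _]]; rewrite /fixed_regs /=.
case: stk ne sk => [|[v x] [|y stk]] // _ sk; last first.
  by rewrite /= addKn muln_eq0 /=; case: v sk.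
case: sk => /=; rewrite muln0 addn0 subnn => -> _ _.
by case: v => [|v] //=; rewrite subn_eq0 (allE N).
Qed.

Definition verifier : com :=
  copy;; rz <- rC;; ru <- Cst 0;; branching;; degrees;; machine;; accept.

Lemma verifier_sem s z : frame s -> regs s rC = z -> z <= 2 ^ (32 * k) ->
  frame (sem verifier s) /\
  regs (sem verifier s) rok = verify E0 k eta (32 * k) lo z.
Proof.
move=> fr ez zb; rewrite /verifier 6!sem_seq !sem_asg.
have [fr1 mx1] := copy_sem fr; have ez1 : regs (sem copy s) rC = z by rewrite sem_frame.
move: (sem copy s) fr1 mx1 ez1 => s1 fr1 mx1 ez1.
set s2 := set_reg _ _ _.
have r2 : rep1 s2 (E0, z, 0).
  by split=> //; rewrite /s2; do 2!(apply: frame_set => //).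
have := branching_sem r2; rewrite /verify.
case: (iter k.+1 _ _) => [[E1 z1] u1] [fr3 mx3 ez3 eu3 zb3].
have [fr4 tb4] := degrees_sem fr3 mx3.
have ez4 : regs (sem degrees (sem branching s2)) rz = z1 by rewrite sem_frame.
have eu4 : regs (sem degrees (sem branching s2)) ru = u1 by rewrite sem_frame.
have [z' h5] := machine_sem fr4 tb4 ez4 zb3.
by have := accept_sem h5; rewrite eu4.
Qed.

End Verifier.

(** * Search over lower bounds and certificates, and set-up of the registers *)

Definition search : com :=
  rans <- Cst 0;;
  For rLo rN1 (rHi <- rLo [+] rEta;;
    For rC rZ (verifier;; Cond rok (rans <- Cst 1) CSkip)).

Definition ready (n k eta : nat) (E : {set {set 'I_n}}) (s : state) : Prop :=
  (forall r, r < 10 -> regs s r = fixed_regs n k eta 0 r) /\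
  (forall i j : 'I_n, Defs.mem s (i * n + j) = adj E i j).

Lemma fixed_regs_lo n k eta lo lo' r : r < 10 ->
  fixed_regs n k eta lo r = fixed_regs n k eta lo' r.
Proof. by do 10!(case: r => [|r] //). Qed.

Lemma search_sem n k eta (E : {set {set 'I_n}}) s : ready k eta E s ->
  regs (sem search s) rans = has (fun lo => has (verify E k eta (32 * k) lo)
    (iota 0 (2 ^ (32 * k)))) (iota 0 n.+1).
Proof.
move=> [h1 h2]; rewrite /search sem_seq sem_asg.
set b := (_;; _); set s1 := set_reg s _ _.
pose ver lo := verify E k eta (32 * k) lo.
pose P i s' := ready k eta E s' /\
  regs s' rans = has (fun lo => has (ver lo) (iota 0 (2 ^ (32 * k)))) (iota 0 i).
have := @sem_for P rLo rN1 b s1 isT.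
have -> : regs s1 rN1 = n.+1 by rewrite /= /upd /= h1.
case=> //.
  split=> //; split=> // r r10; rewrite /= /upd /= !ltn_eqF ?h1 //.
  exact: leq_trans r10 _.
move=> i s' im ei [[r1 r2] ea]; rewrite /b sem_seq sem_asg.
set s2 := set_reg s' _ _.
have fr2 : frame k eta i E s2.
  split=> // r; rewrite ltnS leq_eqVlt => /orP[/eqP ->|].
    by rewrite /= /upd /= ei r1.
  rewrite ltnS leq_eqVlt => /orP[/eqP ->|r10]; first by rewrite /= /upd /= ei.
  by rewrite /= /upd ltn_eqF ?r1 ?(fixed_regs_lo _ _ _ 0 i) // ltnS ltnW.
pose Q j s' := frame k eta i E s' /\ regs s' rans =
  has (fun lo => has (ver lo) (iota 0 (2 ^ (32 * k)))) (iota 0 i) ||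
  has (ver i) (iota 0 j) :> nat.
have := @sem_for Q rC rZ (verifier;; Cond rok (rans <- Cst 1) CSkip) s2 isT.
rewrite (proj1 fr2 rZ isT); case.
- by split; [exact: frame_set | rewrite orbF].
- move=> j s3 jZ ej [f3 ea3]; rewrite sem_seq.
  have [f4 ok4] := verifier_sem f3 ej (ltnW jZ).
  have ea4 : regs (sem verifier s3) rans = regs s3 rans by rewrite sem_frame.
  move: (sem verifier s3) f4 ok4 ea4 => s4 f4 ok4 ea4.
  rewrite /Q -[in iota 0 j.+1]addn1 iotaD has_cat !semE /= ok4 orbF add0n orbA.
  rewrite -/(ver i j); case: (ver i j) => /=.
    by split; [do 2!(apply: frame_set => //) | rewrite /= /upd /= orbT].
  by split; [apply: frame_set | rewrite orbF /= /upd /= ea4].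
- move=> f5 ea5; set s5 := sem _ _ in f5 ea5 *; split.
    split; last by case: f5.
    move=> r r10; rewrite /= /upd ltn_eqF // (proj1 f5) ?(fixed_regs_lo _ _ _ i 0) //.
    exact: leq_trans r10 _.
  rewrite -[in iota 0 i.+1]addn1 iotaD has_cat /= orbF add0n.
  by rewrite /upd /= ea5.
Qed.

Definition double (r : nat) : com := r <- r [+] r.

(** The square is a repeated addition into [rNN], which the input convention leaves at 0; five
    doublings give [32 * k]. *)
Definition setup1 : com :=
  For ri rN (rNN <- rNN [+] rN);;
  (rN1 <- rN [+] Cst 1;; rK1 <- rK [+] Cst 1;; rM <- rK);;
  (double rM;; double rM;; double rM;; double rM;; double rM);;
  rD <- rNN [+] rNN;; rS <- rD [+] rN1.

Definition setup2 : com := rZ <- Cst 1;; For ri rM (double rZ).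

Lemma double_sem r s : regs (sem (double r) s) r = 2 * regs s r.
Proof. by rewrite /double sem_asg /= /upd eqxx mul2n addnn. Qed.

Lemma setup1_sem n (E : {set {set 'I_n}}) k eta r : r < 10 -> r != rZ ->
  regs (sem setup1 (input E k eta)) r = fixed_regs n k eta 0 r.
Proof.
rewrite /setup1; set s0 := input E k eta; rewrite 3!sem_seq.
set c1 := For _ _ _; set c2 := (rN1 <- _;; _).
set c3 := (double rM;; _); set c4 := (rD <- _;; _).
have nn1 : regs (sem c1 s0) rNN = n * n.
  have := @sem_for (fun i s' => regs s' rN = n /\ regs s' rNN = i * n)
    ri rN (rNN <- rNN [+] rN) s0 isT; case=> //.
  move=> i s' _ _ [e1 e2]; rewrite sem_asg /= /upd /= e1 e2; split=> //.
  by rewrite mulSn addnC.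
have r0 : regs (sem c1 s0) rN = n by rewrite sem_frame.
have rk : regs (sem c1 s0) rK = k by rewrite sem_frame.
have re : regs (sem c1 s0) rEta = eta by rewrite sem_frame.
move: (sem c1 s0) nn1 r0 rk re => s1 nn1 r0 rk re.
have h2 x : x \notin mods c2 -> regs (sem c2 s1) x = regs s1 x by apply: sem_frame.
have n1 : regs (sem c2 s1) rN1 = n.+1 by rewrite /c2 !semE /= /upd /= r0 addn1.
have k1 : regs (sem c2 s1) rK1 = k.+1 by rewrite /c2 !semE /= /upd /= rk addn1.
have eM : regs (sem c2 s1) rM = k by rewrite /c2 !semE /= /upd /= rk.
rewrite -(h2 rNN isT) in nn1; rewrite -(h2 rN isT) in r0.
rewrite -(h2 rK isT) in rk; rewrite -(h2 rEta isT) in re.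
move: (sem c2 s1) nn1 r0 rk re n1 k1 eM {h2} => s2 nn1 r0 rk re n1 k1 eM.
have h3 x : x \notin mods c3 -> regs (sem c3 s2) x = regs s2 x by apply: sem_frame.
have {}eM : regs (sem c3 s2) rM = 32 * k.
  by rewrite /c3 4!sem_seq !double_sem eM !mulnA.
rewrite -(h3 rNN isT) in nn1; rewrite -(h3 rN isT) in r0.
rewrite -(h3 rK isT) in rk; rewrite -(h3 rEta isT) in re.
rewrite -(h3 rN1 isT) in n1; rewrite -(h3 rK1 isT) in k1.
move: (sem c3 s2) nn1 r0 rk re n1 k1 eM {h3} => s3 nn1 r0 rk re n1 k1 eM.
rewrite /c4 !semE.
by do 10!(case: r => [|r]; [by move=> _ /eqP ?; rewrite /= /upd /= ?nn1 ?n1 | ]).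
Qed.

Lemma setup2_sem n (E : {set {set 'I_n}}) k eta :
  ready k eta E (sem setup2 (sem setup1 (input E k eta))).
Proof.
have v1 := @setup1_sem n E k eta.
have m1 : Defs.mem (sem setup1 (input E k eta)) = Defs.mem (input E k eta).
  exact: sem_nostore.
move: (sem setup1 _) v1 m1 => s1 v1 m1; split; last first.
  move=> i j; rewrite sem_nostore // m1 /=; congr nat_of_bool.
  apply/existsP/idP => [[i' /existsP[j' /andP[e a]]]|a].
    move: e; rewrite -(eqn_add2l (n * n)) !addnA addr_eq => /andP[/eqP -> /eqP ->].
    exact: a.
  by exists i; apply/existsP; exists j; rewrite eqxx.
move=> r r10; have [->|rZ6] := eqVneq r rZ; last first.
  rewrite sem_frame ?v1 //; rewrite !inE !negb_or rZ6.
  by rewrite neq_ltn (leq_trans r10).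
rewrite /setup2 sem_seq sem_asg; set s2 := set_reg _ _ _.
have := @sem_for (fun i s' => regs s' rZ = 2 ^ i) ri rM (double rZ) s2 isT.
have -> : regs s2 rM = 32 * k by rewrite /s2 /= /upd /= v1.
apply=> // i s' _ _ e.
transitivity (regs (sem (double rZ) s') rZ); first by [].
by rewrite double_sem e expnS.
Qed.

Definition answer : com := rN <- rans.

Lemma compile_run K B c s sg t0 s0 p : com_below K c -> limits_fixed c ->
  (forall r, r \in limits c -> regs sg r <= B) -> agree K s sg ->
  exec p s0 t0 s ->
  exists t s', [/\ exec (Seq p (compile K c)) s0 t s', t <= t0 + com_time B c &
                   agree K s' (sem c sg)].
Proof.
move=> h1 h2 h3 h4 h5; have [t [s' [x tb ag]]] := compile_correct h1 h2 h3 h4.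
by exists (t0 + t), s'; split=> //; [exact: ExecSeq h5 x | rewrite leq_add2l].
Qed.

(* The factor n^{O(1)} is rendered as (n + 1)^d so that the bound is also
   meaningful for the empty graph. *)
Theorem mainTheorem5 :
  exists (P : prog) (C c d : nat),
  forall (n : nat) (E : {set {set 'I_n}}) (k eta : nat),
    E \subset pairs 'I_n ->
    exists (t : nat) (s : state),
      [/\ exec P (input E k eta) t s,
          t <= C * 2 ^ (c * k) * n.+1 ^ d &
          output s = balanced_cluster_editing E k eta :> nat].
Proof.
have [C [d Cd]] := com_time_poly (setup1;; setup2;; search;; answer).
(* The phases are compiled separately because [limits_fixed] holds only phase by phase: the set-up
   computes loop limits of later phases, and [answer] overwrites [rN]. *)
exists (Seq (Seq (Seq (compile 32 setup1) (compile 32 setup2)) (compile 32 search))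
  (compile 32 answer)), (C * 2 ^ d), (32 * d), (2 * d) => n E k eta Ep.
(* Dominates all limits: [n], [n * n], [n + 1], [k + 1], [32 * k] and [2 ^ (32 * k)]. *)
pose B := n.+1 ^ 2 * 2 ^ (32 * k).
have Z0 : 0 < 2 ^ (32 * k) by rewrite expn_gt0.
have kZ : 32 * k < 2 ^ (32 * k) by apply: ltn_expl.
have rd := setup2_sem E k eta.
have eM : regs (sem setup1 (input E k eta)) rM = 32 * k by rewrite setup1_sem.
set s0 := input E k eta in eM rd *.
have [||t1 [s1 [x1 T1 a1]]] := @compile_correct 32 B setup1 s0 s0 isT isT.
- by move=> r; rewrite inE => /eqP ->; rewrite /= /B; nia.
- by [].
have [|t2 [s2 [x2 T2 a2]]] := @compile_run 32 B setup2 _ _ _ _ _ isT isT _ a1 x1.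
- by move=> r; rewrite inE => /eqP ->; rewrite eM /B; nia.
have [|t3 [s3 [x3 T3 a3]]] := @compile_run 32 B search _ _ _ _ _ isT isT _ a2 x2.
- move=> r rl; have rin_ : r \in [:: rN; rNN; rN1; rK1; rZ; rM].
    by apply: (allP (_ : all (fun r => r \in [:: rN; rNN; rN1; rK1; rZ; rM])
      (limits search))) rl.
  rewrite (proj1 rd); last by move: rin_; rewrite !inE; do 5?[case/orP]; move/eqP->.
  move: rin_; rewrite !inE /B.
  by do 5?[case/orP]; move/eqP->; rewrite /fixed_regs /=; nia.
have [|t4 [s4 [x4 T4 a4]]] := @compile_run 32 B answer _ _ _ _ _ isT isT _ a3 x3.
- by [].
exists t4, s4; split=> //.
  apply: (@leq_trans (com_time B (setup1;; setup2;; search;; answer))).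
    have -> : com_time B (setup1;; setup2;; search;; answer) = com_time B setup1
      + (com_time B setup2 + (com_time B search + com_time B answer)) by [].
    move: (com_time B setup1) (com_time B setup2) (com_time B search)
      (com_time B answer) T1 T2 T3 T4; clear; lia.
  apply: leq_trans (Cd B) _.
  (* [B.+1 <= 2 * B], which accounts for the factor [2 ^ d] in the constant. *)
  apply: (@leq_trans (C * (2 * B) ^ d)).
    rewrite leq_mul2l; apply/orP; right; case: (d) => // e; rewrite leq_exp2r //.
    by rewrite mul2n -addnn -addn1 leq_add2l /B muln_gt0 expn_gt0.
  have Bd : B ^ d = 2 ^ (32 * d * k) * n.+1 ^ (2 * d).
    by rewrite /B expnMn -!expnM mulnC [32 * k * d]mulnAC.
  by rewrite expnMn Bd !mulnA.
rewrite /output (proj1 a4) // /answer sem_asg /= /upd /= (search_sem rd).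
congr nat_of_bool; apply/idP/idP.
  case/hasP=> lo; rewrite mem_iota ltnS /= => lon /hasP[z].
  rewrite mem_iota /= => zb v; apply/(verify_correct _ _ Ep).
  by exists lo, z.
case/(verify_correct _ _ Ep) => lo [z [lon zb v]].
apply/hasP; exists lo; first by rewrite mem_iota ltnS.
by apply/hasP; exists z; rewrite ?mem_iota.
Qed.
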